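(* Let $k\ge1$, let $\alpha_1,\beta_1,\beta_2\in\mathbb{R}$ with $\alpha_1^2+\beta_1\beta_2\ne\frac14$, assume a uniform mesh of size $h$, and suppose $|\Gamma|=|\Lambda|$ (Case 2) and that $P_h^\star$ is well defined, i.e. $N$ is odd and $\Gamma=-\Lambda$ if $k$ is odd, $\Gamma=\Lambda$ if $k$ is even. Then for $p=2,\infty$ and periodic $u\in W^{k+1,\infty}(I)$, $$\|P_h^\star u-u\|_{L^p(I)}\le Ch^{k+1}|u|_{W^{k+1,\infty}(I)}\Bigg(1+h^{-1}\Big(1+\frac{h^{-1}\|Q_2\|_\infty}{|\Gamma|}\Big)\Big(\|V_1\|_\infty+h^{-1}\|V_2\|_\infty\Big)\Bigg).$$
   Context: Mesh: $I=[a,b]$, $a=x_{1/2}<\dots<x_{N+1/2}=b$, $I_j=(x_{j-1/2},x_{j+1/2})$, uniform with $h=(b-a)/N$. $V_h^k$ is the space of functions on $I$ whose restriction to each $I_j$ is a polynomial of degree at most $k$. At an interface, $v^\pm$ denote the limits from the right ($+$) and left ($-$) cells, with periodic identification of $x_{1/2}$ and $x_{N+1/2}$; $[v]=v^+-v^-$, $\{v\}=\frac12(v^++v^-)$; the same notation is used for the piecewise derivative $v_x$. Projection $P_h^\star$ (depending on $\alpha_1,\beta_1,\beta_2$): for a periodic function $u$, $P_h^\star u$ is the unique $w\in V_h^k$ satisfying, for all $j=1,\dots,N$, (i) $\int_{I_j}w\,v_h\,dx=\int_{I_j}u\,v_h\,dx$ for all $v_h\in P^{k-2}(I_j)$ (void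 if $k=1$); (ii) $\{w\}-\alpha_1[w]+\beta_2[w_x]=u$ at $x_{j+1/2}$; (iii) $\{w_x\}+\alpha_1[w_x]+\beta_1[w]=u_x$ at $x_{j+1/2}$. Quantities: $\Gamma=\beta_1+\frac{k^2(k^2-1)}{h^2}\beta_2-\frac{2k^2}{h}(\alpha_1^2+\beta_1\beta_2+\frac14)$, $\Lambda=-\frac{2k}{h}(\alpha_1^2+\beta_1\beta_2-\frac14)$, $c_2=\frac{2k\alpha_1}{h}$, $b_1=-\beta_1-\frac{k^2(k^2+1)}{h^2}\beta_2+\frac{2k^2}{h}(\alpha_1^2+\beta_1\beta_2+\frac14)$, $b_2=-\frac{2k^3}{h^2}\beta_2+\frac{2k}{h}(\alpha_1^2+\beta_1\beta_2+\frac14)$, $$Q_2=\begin{bmatrix}c_2&b_1+b_2\\ b_1-b_2&-c_2\end{bmatrix},\quad V_1=\frac1\Lambda\begin{bmatrix}-\beta_1+\frac{k(k+1)}{h}\big((\frac12-\alpha_1)^2+\beta_1\beta_2\big)\\ \beta_1-\frac{k(k-1)}{h}\big((\frac12-\alpha_1)^2+\beta_1\beta_2\big)\end{bmatrix},\quad V_2=\begin{bmatrix}-\frac{h}{2k}\\ \frac{h}{2k}\end{bmatrix}.$$ $\|\cdot\|_\infty$ is the max norm of vectors and the induced matrix norm. ''Periodic $u\in W^{m,\infty}(I)$'' means that the $(b-a)$-periodic extension of $u$ has this regularity; $|u|_{W^{m,\infty}(I)}$ is the Sobolev seminorm. $C$ is a generic constant independent of $h$, of $\alpha_1,\beta_1,\beta_2$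 (which may depend on $h$), and of $u$. *)

(* Defs.v *)
From HB Require Import structures.
From mathcomp Require Import all_boot all_order all_algebra.
From mathcomp Require Import all_classical all_reals all_analysis.

Set Implicit Arguments.
Unset Strict Implicit.
Unset Printing Implicit Defensive.

Import Order.TTheory GRing.Theory Num.Theory.
Import numFieldNormedType.Exports.

Local Open Scope classical_set_scope.
Local Open Scope ring_scope.

Section Sobolev.
Variable R : realType.
Implicit Types (u g phi : R -> R) (m : nat) (I : set R) (p : \bar R).

Definition smooth phi := forall n x, derivable (derive1n n phi) x 1.

Definition test_function phi :=
  smooth phi /\ exists M : R, forall x, M < `|x| -> phi x = 0.

Definition is_weak_derivative m u g :=
  [/\ locally_integrable setT u, locally_integrable setT g &
      forall phi, test_function phi ->
        (\int[lebesgue_measure]_x (u x * derive1n m phi x))%R =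
        (-1) ^+ m * (\int[lebesgue_measure]_x (g x * phi x))%R].

(* membership in W^{m,oo}(R) *)
Definition sobolev_oo m u :=
  forall i, (i <= m)%N ->
    exists2 g, is_weak_derivative i u g & g \in Lfun lebesgue_measure +oo%E.

(* a choice of weak derivative, which is unique almost everywhere *)
Definition weak_derivative m u : R -> R :=
  xget (fun=> 0) [set g | is_weak_derivative m u g].

Definition Lpnorm p I u : \bar R :=
  ('N[lebesgue_measure]_p[EFin \o (u \_ I)])%E.

Definition sobolev_seminorm_oo m I u : \bar R :=
  Lpnorm +oo%E I (weak_derivative m u).

End Sobolev.

Section Mesh.
Variable R : realType.
Variables (a b : R) (N : nat).

Definition mesh_size : R := (b - a) / N%:R.

(* node j is x_{j+1/2}, for j = 0, ..., N *)
Definition node (j : nat) : R := a + j%:R * mesh_size.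

(* cells are numbered from 0: cell j is the interval I_{j+1} *)
Definition cell (j : nat) : set R := `]node j, node j.+1[.

Definition Vh (k : nat) (w : R -> R) :=
  forall j, (j < N)%N -> exists2 q : {poly R}, (size q <= k.+1)%N &
    forall x, cell j x -> w x = q.[x].

(* Traces at node j.+1, the right end of cell j. The neighbour on the right of
   the last cell is the first one, hence the modulus. *)
Definition trm (v : R -> R) (j : nat) : R := lim (v y @[y --> (node j.+1)^'-]).
Definition trp (v : R -> R) (j : nat) : R :=
  lim (v y @[y --> (node (j.+1 %% N))^'+]).

Definition jump (v : R -> R) (j : nat) : R := trp v j - trm v j.
Definition avg (v : R -> R) (j : nat) : R := (trp v j + trm v j) / 2.

(* The function w is P_h^* u. Polynomials of degree at most k - 2 have
   size at most k.-1; for k = 1 only the zero polynomial is left. *)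
Definition is_Pstar (k : nat) (alpha1 beta1 beta2 : R) (u w : R -> R) :=
  Vh k w /\
  forall j, (j < N)%N ->
  [/\ forall v : {poly R}, (size v <= k.-1)%N ->
        (\int[lebesgue_measure]_(x in cell j) (w x * v.[x]))%R =
        (\int[lebesgue_measure]_(x in cell j) (u x * v.[x]))%R,
      avg w j - alpha1 * jump w j + beta2 * jump (derive1 w) j = u (node j.+1) &
      avg (derive1 w) j + alpha1 * jump (derive1 w) j + beta1 * jump w j
        = derive1 u (node j.+1)].

End Mesh.

Section Quantities.
Variable R : realType.
Variables (k : nat) (h alpha1 beta1 beta2 : R).

Definition Gamma : R :=
  beta1 + k%:R ^+ 2 * (k%:R ^+ 2 - 1) / h ^+ 2 * beta2
  - 2 * k%:R ^+ 2 / h * (alpha1 ^+ 2 + beta1 * beta2 + 1 / 4).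

Definition Lambda : R :=
  - (2 * k%:R / h) * (alpha1 ^+ 2 + beta1 * beta2 - 1 / 4).

Definition c2 : R := 2 * k%:R * alpha1 / h.

Definition b1 : R :=
  - beta1 - k%:R ^+ 2 * (k%:R ^+ 2 + 1) / h ^+ 2 * beta2
  + 2 * k%:R ^+ 2 / h * (alpha1 ^+ 2 + beta1 * beta2 + 1 / 4).

Definition b2 : R :=
  - (2 * k%:R ^+ 3 / h ^+ 2) * beta2
  + 2 * k%:R / h * (alpha1 ^+ 2 + beta1 * beta2 + 1 / 4).

Definition mx22 (x00 x01 x10 x11 : R) : 'M[R]_2 :=
  \matrix_(i < 2, j < 2)
    if i == 0 then (if j == 0 then x00 else x01)
    else (if j == 0 then x10 else x11).

Definition cv2 (x0 x1 : R) : 'cV[R]_2 := \col_(i < 2) if i == 0 then x0 else x1.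

Definition Q2 : 'M[R]_2 := mx22 c2 (b1 + b2) (b1 - b2) (- c2).

Definition V1 : 'cV[R]_2 :=
  Lambda^-1 *: cv2
    (- beta1 + k%:R * (k%:R + 1) / h
               * ((1 / 2 - alpha1) ^+ 2 + beta1 * beta2))
    (beta1 - k%:R * (k%:R - 1) / h
               * ((1 / 2 - alpha1) ^+ 2 + beta1 * beta2)).

Definition V2 : 'cV[R]_2 := cv2 (- (h / (2 * k%:R))) (h / (2 * k%:R)).

End Quantities.

(* The library norm `|A| is the largest absolute value of an entry. On column
   vectors this is the max norm; on matrices it is not the induced norm. *)
Definition induced_norm (R : realType) (n : nat) (A : 'M[R]_n) : R :=
  sup [set `|A *m x| | x in [set x : 'cV[R]_n | `|x| <= 1]].

(* Main.v *)
Require Import Defs.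
From HB Require Import structures.
From mathcomp Require Import all_boot all_order all_algebra.
From mathcomp Require Import all_classical all_reals all_analysis.
From mathcomp Require Import measurable_realfun ess_sup_inf.
From mathcomp Require Import ring lra.

Set Implicit Arguments.
Unset Strict Implicit.
Unset Printing Implicit Defensive.

Import Order.TTheory GRing.Theory Num.Theory.
Import numFieldNormedType.Exports.

Local Open Scope classical_set_scope.
Local Open Scope ring_scope.

(** On each cell split [w - p], with [p] an interpolant of [u], into Legendre
    polynomials. The moment conditions bound all the coefficients but the last
    two. The interface conditions couple the last two coefficients of adjacent
    cells; solving for the left cell, and shifting so that only the error in
    the derivative at the right end and in the value at the left end remain,
    gives a periodic recurrence
      [x_j + (I + Q_2 / Gamma) x_{j+1} = - (V_2 gm_j + V_1 gp_{j+1})].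
    In Case 2 the matrix [Q_2] is nilpotent of order two. Applying [Q_2] to the
    recurrence thus leaves an alternating scalar recurrence, which for odd [N]
    costs a factor [N / 2] (that is [h^-1]) and has to be used twice.

    The interpolation error only requires a bound on divided differences of
    [u], which is inherited from mollifications of [u] through Rolle's theorem. *)

(** * Mollifiers *)

Section SmoothFunctions.
Variable R : realType.
Implicit Types (P Q : {poly R}) (x y a b : R) (f g : R -> R).

(** [Q_2] has trace zero and [c2^2 + (b1 + b2) (b1 - b2) = Gamma^2 - Lambda^2], so
    [|Gamma| = |Lambda|] is exactly what makes its square vanish. The sign condition tied to the
    parity of [k] puts [+ I] rather than [- I] into the recurrence; sums of neighbours are then
    controlled, and a turn around an odd number of cells leaves [2 z_j] instead of a cancellation.

    A cell carries four defects, of value and derivative at either end, whereas the bound has room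
    for two columns only. Shifting the last two Legendre coefficients gives two free parameters,
    which remove two defects; inverting the left-cell matrix, whose determinant is [Lambda], turns
    the other two into [V_1] and [V_2].

    The interface conditions involve the pointwise derivative of [u], while regularity is given
    through weak derivatives, so differentiability itself is drawn from divided differences. Taking
    both ends of a cell as interpolation nodes makes the error a multiple of the distance to an end,
    which bounds the derivative error there. *)

Lemma is_derive_cvg f x l :
  h^-1 * (f (h + x) - f x) @[h --> 0^'] --> l -> is_derive x 1 f l.
Proof.
move=> fl; have H : h^-1 *: (f (h *: 1 + x) - f x) @[h --> 0^'] --> l.
  by under eq_fun do rewrite scaler1.
apply: DeriveDef; first by apply/cvg_ex; exists l.
exact: cvg_lim.
Qed.

Lemma horner_norm_le P : exists2 C : R, 0 <= C &
  forall y, 1 <= y -> `|P.[y]| <= C * y ^+ (size P).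
Proof.
exists (\sum_(i < size P) `|P`_i|); first exact: sumr_ge0.
move=> y y1; rewrite horner_coef mulr_suml.
apply: le_trans (ler_norm_sum _ _ _) _; apply: ler_sum => i _.
rewrite normrM ler_wpM2l// normrX ger0_norm ?(le_trans ler01)//.
by rewrite ler_weXn2l// ltnW.
Qed.

(** Carrying a polynomial in [x^-1] in front of [expR (- x^-1)] makes the family closed under
    differentiation, so a single derivative computation yields all orders. *)
Definition flat P x : R := if 0 < x then P.[x^-1] * expR (- x^-1) else 0.

(** With [n] the size of [P] and [y = x^-1], the exponential series gives
    [expR y >= y^(n+1) / (n+1)!], one power more than the growth of [P]; the spare power is the
    factor [x]. *)
Lemma flat_le P : exists C : R, forall x, 0 < x -> x <= 1 -> `|flat P x| <= C * x.
Proof.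
have [C C0 HC] := horner_norm_le P; set n := size P in HC.
exists (C * (n.+1)`!%:R) => x x0 x1; rewrite /flat x0.
have y1 : 1 <= x^-1 by rewrite invf_ge1.
rewrite normrM (ger0_norm (expR_ge0 _)).
apply: le_trans (ler_wpM2r (expR_ge0 _) (HC _ y1)) _.
rewrite -!mulrA ler_wpM2l// expRN.
have y0 : 0 <= x^-1 by rewrite (le_trans ler01).
have He := expR_ge1Dxn n y0.
rewrite ler_pdivrMr ?expR_gt0//.
have f0 : 0 < (n.+1)`!%:R :> R by rewrite ltr0n fact_gt0.
have : x^-1 ^+ n.+1 / (n.+1)`!%:R <= expR x^-1 by apply: le_trans He; rewrite lerDr.
rewrite ler_pdivrMr// exprS => He2.
have -> : x^-1 ^+ n = x * (x^-1 * x^-1 ^+ n) by rewrite mulrA divff ?mul1r ?gt_eqF.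
rewrite -[leRHS]mulrA [leRHS]mulrCA; apply: ler_wpM2l; first exact: ltW.
by rewrite [leRHS]mulrC.
Qed.

(** With [y = x^-1] the chain rule gives [- y^2 (P'(y) - P(y)) expR (- y)], the origin of the new
    polynomial. Only [x = 0] needs an estimate. *)
Lemma is_derive_flat P x : is_derive x 1 (flat P) (flat ('X^2 * (P - P^`())) x).
Proof.
have [x0|x0|x0] := ltgtP 0 x.
- have -> : flat ('X^2 * (P - P^`())) x =
     P.[x^-1] * (expR (- x^-1) * x^-2) + expR (- x^-1) * (P^`().[x^-1] * (- x^-2)).
    by rewrite /flat x0 hornerM hornerXn hornerD hornerN exprVn; ring.
  apply: (@near_eq_is_derive _ _ _ (fun y => P.[y^-1] * expR (- y^-1))).
  + near=> y; rewrite /flat ifT//; near: y; exact: lt_nbhsr.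
  have xn0 : x != 0 by rewrite gt_eqF.
  have dV : is_derive x 1 (fun y : R => y^-1) (- x^-2).
    by have := @is_deriveV _ id x _ 1 xn0 (is_derive_id _ _); rewrite scaler1.
  have d1 : is_derive x 1 (fun y : R => P.[y^-1]) (P^`().[x^-1] * (- x^-2)).
    exact: (is_derive1_comp (is_derive_poly _ _) dV).
  have d2 : is_derive x 1 (fun y : R => expR (- y^-1)) (expR (- x^-1) * x^-2).
    apply: (is_derive1_comp (is_derive_expR _)).
    by rewrite -[X in is_derive _ _ _ X]opprK; exact: is_deriveN.
  exact: is_deriveM.
- have -> : flat ('X^2 * (P - P^`())) x = 0 by rewrite /flat ltNge ltW.
  apply: (@near_eq_is_derive _ _ _ (cst 0)).
  near=> y; rewrite /flat ltNge ltW//; near: y.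
  exact: lt_nbhsl.
- rewrite -{}x0; have -> : flat ('X^2 * (P - P^`())) 0 = 0 by rewrite /flat ltxx.
  apply: is_derive_cvg.
  have [C HC] := flat_le ('X * P).
  apply/cvgr0Pnorm_lt => e e0.
  have C1 : 0 < `|C| + 1 by rewrite ltr_wpDl.
  near=> h.
  have hn0 : h != 0 by near: h; exact: nbhs_dnbhs_neq.
  rewrite addr0 [flat P 0]/flat ltxx subr0.
  have h1 : `|h| <= 1 by near: h; apply: dnbhs0_le.
  have he : `|h| < e / (`|C| + 1) by near: h; apply: dnbhs0_lt; rewrite divr_gt0.
  have [h0|h0] := ltP 0 h; last by rewrite /flat ifF ?mulr0 ?normr0// ltNge h0.
  (* Dividing by [h] multiplies the polynomial by ['X], so [flat_le] for ['X * P] still leaves a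
     factor [h]. *)
  have -> : h^-1 * flat P h = flat ('X * P) h by rewrite /flat h0 hornerM hornerX mulrA.
  rewrite gtr0_norm// in h1 he.
  apply: le_lt_trans (HC _ h0 h1) _.
  rewrite ltr_pdivlMr// in he; apply: le_lt_trans he.
  rewrite mulrC ler_wpM2l ?(ltW h0)//.
  by rewrite (le_trans (ler_norm _))// lerDl.
Unshelve. all: by end_near. Qed.

(** This avoids a formula for the n-th derivative: it is enough to exhibit a class of derivable
    functions stable under [derive1]. *)
Lemma smooth_ind (S : (R -> R) -> Prop) :
  (forall f, S f -> (forall x, derivable f x 1) /\ S (derive1 f)) ->
  forall f, S f -> smooth f.
Proof.
move=> HS f Sf n.
suff : S (derive1n n f) by move=> /HS[].
by elim: n => [//|n IH]; rewrite derive1nS; have [] := HS _ IH.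
Qed.

(** Differences are the only closure required: the argument [b - x] turns the product rule into a
    difference of two products of the same shape. *)
Inductive flat_span a b : (R -> R) -> Prop :=
| flat_span_mul P Q : flat_span a b (fun x => flat P (x - a) * flat Q (b - x))
| flat_span_sub f g : flat_span a b f -> flat_span a b g ->
    flat_span a b (fun x => f x - g x).

Lemma is_derive_flatMflat a b P Q x :
  is_derive x 1 (fun x => flat P (x - a) * flat Q (b - x))
    (flat ('X^2 * (P - P^`())) (x - a) * flat Q (b - x) -
     flat P (x - a) * flat ('X^2 * (Q - Q^`())) (b - x)).
Proof.
have d1 : is_derive x 1 (fun x => flat P (x - a)) (flat ('X^2 * (P - P^`())) (x - a)).
  rewrite -[X in is_derive _ _ _ X]mulr1.
  apply: (@is_derive1_comp _ (flat P) (fun y => y - a) x _ 1 (is_derive_flat P (x - a))).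
  by rewrite -[X in is_derive _ _ _ X]subr0; exact: is_deriveB.
have d2 : is_derive x 1 (fun x => flat Q (b - x)) (flat ('X^2 * (Q - Q^`())) (b - x) * - 1).
  apply: (@is_derive1_comp _ (flat Q) (fun y => b - y) x _ (-1) (is_derive_flat Q (b - x))).
  by rewrite -[X in is_derive _ _ _ X]sub0r; exact: is_deriveB.
apply: (is_derive_eq (is_deriveM d1 d2)).
rewrite /GRing.scale/=; ring.
Qed.

Lemma flat_span_smooth a b f : flat_span a b f -> smooth f.
Proof.
apply: smooth_ind => {}f; elim => [P Q|{}f g _ [df Sf] _ [dg Sg]]; split.
- by move=> x; exact: (@ex_derive _ _ _ _ _ _ _ (is_derive_flatMflat a b P Q x)).
- have -> : derive1 (fun x => flat P (x - a) * flat Q (b - x)) =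
      (fun x => flat ('X^2 * (P - P^`())) (x - a) * flat Q (b - x) -
        flat P (x - a) * flat ('X^2 * (Q - Q^`())) (b - x)).
    apply/funext => x; rewrite derive1E.
    exact: (@derive_val _ _ _ _ _ _ _ (is_derive_flatMflat a b P Q x)).
  exact/flat_span_sub/flat_span_mul/flat_span_mul.
- by move=> x; exact: derivableB.
- have -> : derive1 (fun x => f x - g x) = (fun x => derive1 f x - derive1 g x).
    by apply/funext => x; rewrite !derive1E deriveB.
  exact: flat_span_sub.
Qed.

(** Left unnormalised; its mass is divided out where averages are formed. *)
Definition mollifier a b x : R := flat 1 (x - a) * flat 1 (b - x).

Lemma mollifier_smooth a b : smooth (mollifier a b).
Proof. exact: (flat_span_smooth (flat_span_mul a b 1 1)). Qed.

Lemma mollifier_gt0 a b x : a < x < b -> 0 < mollifier a b x.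
Proof.
move=> /andP[ax xb]; rewrite /mollifier /flat !subr_gt0 ax xb !hornerC !mul1r.
by rewrite mulr_gt0// expR_gt0.
Qed.

Lemma mollifier_eq0 a b x : ~~ (a < x < b) -> mollifier a b x = 0.
Proof.
by rewrite negb_and /mollifier /flat !subr_gt0 => /orP[/negbTE->|/negbTE->];
  rewrite ?mul0r ?mulr0.
Qed.

Lemma mollifier_ge0 a b x : 0 <= mollifier a b x.
Proof.
by have [/mollifier_gt0/ltW//|/mollifier_eq0->] := boolP (a < x < b).
Qed.

End SmoothFunctions.

Section Mollification.
Variable R : realType.
Implicit Types (x y z a b c : R) (f g u eta phi : R -> R).
Local Notation mu := (@lebesgue_measure R).

Lemma derivable_continuous f : (forall x, derivable f x 1) -> continuous f.
Proof. by move=> df x; apply/differentiable_continuous/derivable1_diffP/df. Qed.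

Lemma smooth_continuous f : smooth f -> continuous f.
Proof. by move=> sf; apply: derivable_continuous => x; exact: (sf 0%N). Qed.

Lemma derive1n_derive1 n f : derive1n n (derive1 f) = derive1n n.+1 f.
Proof. by rewrite /derive1n iterSr. Qed.

Lemma smooth_derive1 f : smooth f -> smooth (derive1 f).
Proof. by move=> sf n x; rewrite derive1n_derive1; exact: sf. Qed.

Lemma smooth_derive1n n f : smooth f -> smooth (derive1n n f).
Proof. by move=> sf m x; rewrite /derive1n -iterD; exact: (sf (m + n)%N). Qed.

Lemma is_derive_derive1 f x : derivable f x 1 -> is_derive x 1 f (derive1 f x).
Proof. by rewrite derive1E => /derivableP. Qed.

Lemma derive1_is_derive f x l : is_derive x 1 f l -> derive1 f x = l.
Proof. by move=> df; rewrite derive1E; exact: derive_val. Qed.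

Lemma derive1_shift f c : derive1 (fun z => f (z - c)) = fun z => derive1 f (z - c).
Proof. by apply/funext => z; rewrite /derive1; under eq_fun do rewrite -addrA. Qed.

Lemma derive1n_shift n f c :
  derive1n n (fun z => f (z - c)) = fun z => derive1n n f (z - c).
Proof.
elim: n => [//|n IH].
by rewrite !derive1nS IH (derive1_shift (derive1n n f)).
Qed.

Lemma is_derive_comp_affine f x b c l : is_derive (b * x + c) 1 f l ->
  is_derive x 1 (fun z => f (b * z + c)) (b * l).
Proof.
move=> df; rewrite mulrC.
have da : is_derive x 1 (fun z => b * z + c) b.
  have := is_deriveD (is_deriveZ b (is_derive_id x (1 : R))) (is_derive_cst c x 1).
  by rewrite addr0 /GRing.scale/= mulr1.
exact: (@is_derive1_comp _ f (fun z => b * z + c) x _ b df da).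
Qed.

Lemma derivable_shift f c x : derivable f (x - c) 1 -> derivable (fun z => f (z - c)) x 1.
Proof.
move=> df; have := @is_derive_comp_affine f x 1 (- c) (derive1 f (x - c)).
rewrite mul1r => /(_ (is_derive_derive1 df)) H.
have -> : (fun z => f (z - c)) = (fun z => f (1 * z - c)).
  by apply/funext => z; rewrite mul1r.
exact: (@ex_derive _ _ _ _ _ _ _ H).
Qed.

Lemma smooth_shift f c : smooth f -> smooth (fun z => f (z - c)).
Proof. by move=> sf n x; rewrite derive1n_shift; apply: derivable_shift; exact: sf. Qed.

Definition supported (S : set R) f := forall x, ~ S x -> f x = 0.

Lemma supported_derive1 Z f : supported `[- Z, Z] f -> supported `[- Z, Z] (derive1 f).
Proof.
move=> sf x Zx.
have Zx' : Z < `|x|.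
  by rewrite ltNge; apply/negP => xZ; apply: Zx; rewrite /= in_itv/= -ler_norml.
rewrite derive1E -(derive_cst (0 : R) x 1); apply: near_eq_derive.
have : \forall y \near x, Z < `|y|.
  by have /cvgr_gt := @norm_continuous _ R x; exact.
apply: filterS => y Zy; apply: sf; rewrite /= in_itv/= -ler_norml.
by apply/negP; rewrite -ltNge.
Qed.

Lemma Rintegral_supported (D : set R) f : supported D f ->
  \int[mu]_x f x = \int[mu]_(x in D) f x.
Proof.
move=> sf; rewrite [RHS]Rintegral_mkcond; congr (Rintegral _ _ _).
apply/funext => x; rewrite patchE; case: ifPn => //.
by rewrite notin_setE => /sf.
Qed.

Lemma continuous_integrable_itv a b f :
  continuous f -> mu.-integrable `[a, b] (EFin \o f).
Proof.
move=> cf; apply: continuous_compact_integrable; first exact: segment_compact.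
exact: continuous_subspaceT.
Qed.

Lemma continuous_bounded_itv a b f : continuous f ->
  exists2 C : R, 0 <= C & forall x, x \in `[a, b] -> `|f x| <= C.
Proof.
move=> cf; have [ab|ba] := leP a b; last first.
  by exists 0 => // x; rewrite in_itv/= => /andP[ax xb]; move: (le_trans ax xb); rewrite leNgt ba.
have cn : {within `[a, b], continuous (fun x => `|f x|)}.
  apply: continuous_subspaceT => x; apply: continuous_comp; first exact: cf.
  exact: norm_continuous.
by have [c _ Hc] := EVT_max ab cn; exists `|f c|.
Qed.

End Mollification.

(** * Convolution with a compactly supported smooth kernel *)

Section Convolution.
Variable R : realType.
Implicit Types (x y z a b c : R) (f g u eta phi : R -> R).
Local Notation mu := (@lebesgue_measure R).

Lemma supported_bounded Z f : continuous f -> supported `[- Z, Z] f ->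
  exists2 C : R, 0 <= C & forall x, `|f x| <= C.
Proof.
move=> cf sf; have [C C0 HC] := continuous_bounded_itv (- Z) Z cf.
exists C => // x; have [xZ|xZ] := boolP (x \in `[- Z, Z]); first exact: HC.
by rewrite sf ?normr0//; exact/negP.
Qed.

Lemma continuous_conv_kernel u eta c : continuous u -> continuous eta ->
  continuous (fun z => u z * eta (z - c)).
Proof.
move=> cu ce z; apply: continuousM; first exact: cu.
apply: (@continuous_comp _ _ _ (fun z => z - c) eta); last exact: ce.
by apply: continuousB => //; exact: cst_continuous.
Qed.

(** Differentiation under the integral sign. For [x] within distance 1 of [x0] all kernels live in
    one compact interval [[- W, W]], where the constant [U * E * |l|] dominates the derivative in
    [x]. The scale [l] allows for the contracted averaging points [(1 - e) x]. *)
Lemma is_derive_conv u eta Z l x0 : continuous u -> smooth eta ->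
  supported `[- Z, Z] eta ->
  is_derive x0 1 (fun x => \int[mu]_z (u z * eta (z - l * x)))
    (- l * \int[mu]_z (u z * derive1 eta (z - l * x0))).
Proof.
move=> cu seta sup; set W := `|Z| + `|l| * (`|x0| + 1).
have cont c f : smooth f -> continuous (fun z => u z * f (z - c)).
  by move=> sf; apply: continuous_conv_kernel => //; exact: smooth_continuous.
have supp f x : supported `[- Z, Z] f -> x \in `]x0 - 1, x0 + 1[ ->
    supported `[- W, W] (fun z => u z * f (z - l * x)).
  move=> supf; rewrite in_itv/= => /andP[x1 x2] z zW.
  rewrite supf ?mulr0// => /=; rewrite in_itv/= -ler_norml => zZ; apply: zW.
  rewrite /= in_itv/= -ler_norml /W.
  have -> : z = (z - l * x) + l * x by rewrite subrK.
  apply: le_trans (ler_normD _ _) _; apply: lerD.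
    by apply: le_trans zZ _; exact: ler_norm.
  rewrite normrM ler_wpM2l//.
  have -> : x = x0 + (x - x0) by rewrite addrC subrK.
  apply: le_trans (ler_normD _ _) _; rewrite lerD2l ler_norml; lra.
have x0I : x0 \in `]x0 - 1, x0 + 1[ by rewrite in_itv/=; lra.
pose F x := \int[mu]_(z in `[- W, W]) (u z * eta (z - l * x)).
have nF : \forall x \near x0, F x = \int[mu]_z (u z * eta (z - l * x)).
  near=> x; rewrite (Rintegral_supported (supp _ x sup _))//.
  near: x; exact: near_in_itvoo.
apply: near_eq_is_derive nF _.
have [U U0 HU] := continuous_bounded_itv (- W) W cu.
have [E E0 HE] := supported_bounded (smooth_continuous (smooth_derive1 seta))
  (supported_derive1 sup).
have dk x z : is_derive x 1 (fun x => u z * eta (z - l * x))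
    (- l * (u z * derive1 eta (z - l * x))).
  have -> : - l * (u z * derive1 eta (z - l * x)) =
    u z *: (- l * derive1 eta (- l * x + z)) + eta (- l * x + z) *: 0.
    by rewrite /GRing.scale/= mulr0 addr0 mulrCA [- l * x + z]addrC [- l * x]mulNr.
  have -> : (fun x => u z * eta (z - l * x)) = cst (u z) * (fun x => eta (- l * x + z)).
    by apply/funext => y; rewrite !fctE [- l * y]mulNr [- _ + z]addrC.
  apply: is_deriveM; apply: is_derive_comp_affine.
  by apply: is_derive_derive1; exact: (seta 0%N).
have hint x : x \in `]x0 - 1, x0 + 1[ ->
    mu.-integrable `[- W, W] (EFin \o (fun z => u z * eta (z - l * x))).
  by move=> _; exact: continuous_integrable_itv (cont _ _ seta).
pose G (z : R) : R := U * E * `|l|.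
have G0 z : 0 <= G z by rewrite !mulr_ge0.
have iG : mu.-integrable `[- W, W] (EFin \o G).
  by apply: continuous_integrable_itv; exact: cst_continuous.
have Gub x z : x \in `]x0 - 1, x0 + 1[ -> z \in `[- W, W] ->
    `|partial1of2 (fun x z => u z * eta (z - l * x)) x z| <= G z.
  move=> _ zW; rewrite /partial1of2 (derive1_is_derive (dk x z)).
  rewrite mulrC normrM normrN ler_wpM2r// normrM ler_pM//; first exact: HU.
have mB : measurable `[- W, W]%classic by [].
have dF : derivable F x0 1.
  apply: (@derivable_under_integral _ _ _ mu (fun x z => u z * eta (z - l * x))
    _ mB x0 (x0 - 1) (x0 + 1) x0I hint _ G G0 iG Gub).
  by move=> x z _ _; exact: (@ex_derive _ _ _ _ _ _ _ (dk x z)).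
have -> : - l * (\int[mu]_z (u z * derive1 eta (z - l * x0))) = derive1 F x0.
  rewrite (@differentiation_under_integral _ _ _ mu (fun x z => u z * eta (z - l * x))
    _ mB x0 (x0 - 1) (x0 + 1) x0I hint _ G G0 iG Gub); last first.
    by move=> x z _ _; exact: (@ex_derive _ _ _ _ _ _ _ (dk x z)).
  rewrite (Rintegral_supported (supp _ x0 (supported_derive1 sup) x0I)).
  rewrite -RintegralZl//.
    apply: eq_Rintegral => z _.
    by rewrite /partial1of2 (derive1_is_derive (dk x0 z)).
  by apply: continuous_integrable_itv; apply: cont; exact: smooth_derive1.
exact: is_derive_derive1.
Unshelve. all: by end_near. Qed.

Lemma supported_shift eta Z c : supported `[- Z, Z] eta ->
  supported `[- (`|Z| + `|c|), `|Z| + `|c|] (fun z => eta (z - c)).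
Proof.
move=> sup z zZ; apply: sup => /= zx; apply: zZ; move: zx.
rewrite /= !in_itv/= -!ler_norml => zx; rewrite -[z in `|z|](subrK c).
apply: le_trans (ler_normD _ _) _; rewrite lerD2r.
by apply: le_trans zx _; exact: ler_norm.
Qed.

Lemma Rintegral_derive1_eq0 eta Z : smooth eta -> supported `[- Z, Z] eta ->
  \int[mu]_z derive1 eta z = 0.
Proof.
(* [W] is positive and strictly larger than [Z], so [eta] vanishes at both ends of [[- W, W]]. *)
move=> se sup; set W := `|Z| + 1.
have W0 : 0 < W by rewrite ltr_wpDl.
have ZW : Z < W by rewrite /W; have := ler_norm Z; lra.
have ce := smooth_continuous se.
have zero x : ~~ (- W < x < W) -> eta x = 0.
  move=> xW; apply: sup; rewrite /= in_itv/= => /andP[x1 x2]; move/negP: xW; apply.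
  by apply/andP; split; lra.
have -> : \int[mu]_z derive1 eta z = \int[mu]_(z in `[- W, W]) derive1 eta z.
  apply: Rintegral_supported; apply: supported_derive1 => x xW; apply: zero.
  by apply/negP => /andP[x1 x2]; apply: xW; rewrite /= in_itv/= !ltW.
rewrite /Rintegral (@continuous_FTC2 _ _ eta)//.
- by rewrite !zero ?subee//; [rewrite ltxx|rewrite ltxx andbF].
- by rewrite gtrN.
- by apply: continuous_subspaceT; exact: smooth_continuous (smooth_derive1 se).
- split; first by move=> x _; exact: (se 0%N).
  + by apply: cvg_at_right_filter; exact: ce.
  + by apply: cvg_at_left_filter; exact: ce.
Qed.

(** The shifted mass, as a function of the shift, has derivative minus the integral of a derivative,
    which is zero; hence it is constant. *)
Lemma Rintegral_shift eta Z c : smooth eta -> supported `[- Z, Z] eta ->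
  \int[mu]_z eta (z - c) = \int[mu]_z eta z.
Proof.
move=> se sup; pose F x := \int[mu]_z (1 * eta (z - 1 * x)).
have dF x : is_derive x 1 F 0.
  have cst1 : continuous (fun _ : R => 1 : R) by exact: cst_continuous.
  have := is_derive_conv 1 x cst1 se sup.
  under eq_Rintegral do rewrite mul1r.
  rewrite -(derive1_shift eta) (@Rintegral_derive1_eq0 _ (`|Z| + `|1 * x|)) ?mulr0//.
    exact: smooth_shift.
  exact: supported_shift.
have := is_derive_0_is_cst c 0 dF; rewrite /F.
under eq_Rintegral do rewrite !mul1r; move=> ->.
by under eq_Rintegral do rewrite mul1r mulr0 subr0.
Qed.

End Convolution.

Section Mollify.
Variable R : realType.
Implicit Types (x y z a b c : R) (f g u eta phi psi : R -> R).
Local Notation mu := (@lebesgue_measure R).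

Lemma integrable_supported Z f : continuous f -> supported `[- Z, Z] f ->
  mu.-integrable setT (EFin \o f).
Proof.
move=> cf sf; have := continuous_integrable_itv (- Z) Z cf.
rewrite integrable_mkcond// restrict_EFin; congr (_.-integrable _ _).
apply/funext => x /=; congr EFin; rewrite patchE; case: ifPn => //.
by rewrite notin_setE => /sf.
Qed.

Lemma supported_derive1n n Z f :
  supported `[- Z, Z] f -> supported `[- Z, Z] (derive1n n f).
Proof.
move=> sf; elim: n => [|n IH]; first exact: sf.
by rewrite derive1nS; exact: supported_derive1.
Qed.

Lemma derive1n_conv u eta Z l n : continuous u -> smooth eta ->
  supported `[- Z, Z] eta ->
  derive1n n (fun x => \int[mu]_z (u z * eta (z - l * x))) =
  fun x => (- l) ^+ n * \int[mu]_z (u z * derive1n n eta (z - l * x)).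
Proof.
move=> cu se sup; elim: n => [|n IH].
  by apply/funext => x; rewrite expr0 mul1r.
have supn := supported_derive1n n sup.
rewrite derive1nS {}IH; apply/funext => x; apply: derive1_is_derive.
have := is_deriveZ ((- l) ^+ n) (is_derive_conv l x cu (@smooth_derive1n _ n _ se) supn).
by rewrite /GRing.scale/= exprSr mulrA.
Qed.

Lemma smooth_conv u eta Z l : continuous u -> smooth eta ->
  supported `[- Z, Z] eta -> smooth (fun x => \int[mu]_z (u z * eta (z - l * x))).
Proof.
move=> cu se sup n x; rewrite (derive1n_conv l n cu se sup).
have supn := supported_derive1n n sup.
have := is_deriveZ ((- l) ^+ n) (is_derive_conv l x cu (@smooth_derive1n _ n _ se) supn).
exact: (@ex_derive _ _ _ _ _ _ _).
Qed.

Lemma normr_fine_le (x : \bar R) (y : R) : (`|x| <= y%:E)%E -> `|fine x| <= y.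
Proof. by case: x => [r| |]//=; rewrite lee_fin. Qed.

Lemma normr_Rintegral_ae_le A B (M : R) g psi : 0 <= M ->
  measurable_fun setT g -> continuous psi -> (forall z, 0 <= psi z) ->
  supported `[A, B] psi ->
  {ae mu, forall z, z \in `[A, B] -> `|g z| <= M} ->
  `|\int[mu]_z (g z * psi z)| <= M * \int[mu]_z psi z.
Proof.
move=> M0 mg cpsi psi0 sup gM.
have mpsi : measurable_fun `[A, B] psi.
  by apply: measurable_funTS; exact: continuous_measurable_fun.
have mg' : measurable_fun `[A, B] g by exact: measurable_funTS.
have sup' : supported `[A, B] (fun z => g z * psi z).
  by move=> z /sup ->; rewrite mulr0.
rewrite (Rintegral_supported sup) (Rintegral_supported sup').
apply: normr_fine_le; apply: le_trans.
  apply: le_abse_integral => //; apply/measurable_EFinP; exact: measurable_funM.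
have ipsi := continuous_integrable_itv A B cpsi.
have fpsi : (\int[mu]_(z in `[A, B]) (psi z)%:E)%E \is a fin_num.
  exact: integrable_fin_num.
rewrite EFinM [X in (_ <= _ * X)%E]fineK// -ge0_integralZl_EFin//; last first.
- exact/measurable_EFinP.
- by move=> z _; rewrite lee_fin.
apply: ae_ge0_le_integral => //.
- by apply: measurableT_comp => //; apply/measurable_EFinP; exact: measurable_funM.
- by move=> z _; rewrite mule_ge0// lee_fin.
- by apply/measurable_EFinP; exact: measurable_funM.
move: gM; apply: (@filterS _ _ (ae_filter_ringOfSetsType mu)) => z zM zAB.
by rewrite -EFinM lee_fin normrM (ger0_norm (psi0 z)) ler_wpM2r// zM.
Qed.

Lemma supported_mollifier a b : supported `[- (`|a| + `|b|), `|a| + `|b|] (@mollifier R a b).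
Proof.
move=> x xab; apply: mollifier_eq0; apply/negP => /andP[ax xb]; apply: xab.
rewrite /= in_itv/=; have := ler_norm b; have := ler_norm (- a); rewrite normrN.
have := normr_ge0 a; have := normr_ge0 b => *; apply/andP; split; lra.
Qed.

Lemma mollifier_continuous a b : continuous (@mollifier R a b).
Proof. exact: smooth_continuous (@mollifier_smooth R a b). Qed.

Lemma Rintegral_mollifier_gt0 a b : a < b -> 0 < \int[mu]_z mollifier a b z.
Proof.
(* On the middle third the kernel has a positive minimum, and this minimum times the length bounds
   the mass from below. *)
move=> ab; set c := a + (b - a) / 3; set d := b - (b - a) / 3.
have cd : c < d by rewrite /c /d; lra.
have [e] := EVT_min (ltW cd) (continuous_subspaceT (@mollifier_continuous a b)).
rewrite in_itv/= => /andP[ce ed] He.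
have e0 : 0 < mollifier a b e.
  by apply: mollifier_gt0; move: ce ed; rewrite /c /d => *; apply/andP; split; lra.
have icst : mu.-integrable `[c, d] (EFin \o cst (mollifier a b e)).
  by apply: continuous_integrable_itv; exact: cst_continuous.
apply: (@lt_le_trans _ _ (mollifier a b e * (d - c))).
  by rewrite mulr_gt0// subr_gt0.
have -> : d - c = fine (mu `[c, d]) by rewrite lebesgue_measure_itv/= lte_fin cd.
rewrite -Rintegral_cst//.
apply: (@le_trans _ _ (\int[mu]_(z in `[c, d]) mollifier a b z)).
  apply: le_Rintegral => //.
  by apply: continuous_integrable_itv; exact: mollifier_continuous.
have ib := integrable_supported (@mollifier_continuous a b) (@supported_mollifier a b).
rewrite -lee_fin /Rintegral !fineK.
- apply: ge0_subset_integral => //.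
  + by apply/measurable_EFinP; exact: continuous_measurable_fun (@mollifier_continuous a b).
  + by move=> z _; rewrite lee_fin mollifier_ge0.
- exact: integrable_fin_num.
- apply: integrable_fin_num => //.
  by apply: continuous_integrable_itv; exact: mollifier_continuous.
Qed.

End Mollify.

(** * Divided differences of functions with a bounded weak derivative *)

Section WeakApprox.
Variable R : realType.
Implicit Types (x y z a b c A B M : R) (f g u eta phi psi : R -> R).
Local Notation mu := (@lebesgue_measure R).

Lemma supported_conv_kernel u eta Z c : supported `[- Z, Z] eta ->
  supported `[- (`|Z| + `|c|), `|Z| + `|c|] (fun z => u z * eta (z - c)).
Proof. by move=> /(@supported_shift _ _ _ c) sup z /sup ->; rewrite mulr0. Qed.

Lemma integrable_conv_kernel u eta Z c : continuous u -> continuous eta ->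
  supported `[- Z, Z] eta ->
  mu.-integrable setT (EFin \o (fun z => u z * eta (z - c))).
Proof.
move=> cu ce sup; have sup' := @supported_conv_kernel u eta Z c sup.
by apply: integrable_supported sup'; exact: continuous_conv_kernel.
Qed.

Lemma mollifier_near_convex A B e x z : x \in `[A, B] -> 0 < e < 1 ->
  mollifier (e * A) (e * B) (z - (1 - e) * x) != 0 ->
  z \in `[A, B] /\ `|x - z| <= e * (B - A).
Proof.
rewrite in_itv/= => /andP[Ax xB] /andP[e0 e1] m0.
have /andP[h1 h2] : e * A < z - (1 - e) * x < e * B.
  by apply: contraNT m0 => /mollifier_eq0 ->.
have h3 : e * A <= e * x by rewrite ler_wpM2l// ltW.
have h4 : e * x <= e * B by rewrite ler_wpM2l// ltW.
have h5 : (1 - e) * A <= (1 - e) * x by rewrite ler_wpM2l// subr_ge0 ltW.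
have h6 : (1 - e) * x <= (1 - e) * B by rewrite ler_wpM2l// subr_ge0 ltW.
by rewrite in_itv/= ler_norml; split; [apply/andP; split|apply/andP; split]; nra.
Qed.

(* Since [z - (1 - e) x] in the support [e A, e B] of the kernel forces [z] to
   be a convex combination of points of [A, B], averaging never uses values
   of [g] outside of [A, B], even at the end points. *)
Lemma weak_derivative_approx A B M m u g : A < B -> continuous u ->
  is_weak_derivative m u g -> 0 <= M ->
  {ae mu, forall z, z \in `[A, B] -> `|g z| <= M} ->
  exists f_ : nat -> R -> R, [/\ forall n, smooth (f_ n),
    forall n x, x \in `[A, B] -> `|derive1n m (f_ n) x| <= M &
    forall x, x \in `[A, B] -> f_ n x @[n --> \oo] --> u x].
Proof.
move=> AB cu [_ [mg _ _] wug] M0 gM.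
(* The index [n.+2] keeps the contraction strictly between 0 and 1 from [n = 0] on. *)
pose e n : R := n.+2%:R^-1.
have e01 n : 0 < e n < 1.
  by rewrite /e invr_gt0 ltr0n/= invf_lt1 ?ltr0n// ltr1n.
pose phi n := mollifier (e n * A) (e n * B).
pose c n := \int[mu]_z phi n z.
have c0 n : 0 < c n.
  by apply: Rintegral_mollifier_gt0; rewrite ltr_pM2l//; have /andP[] := e01 n.
pose Z n := `|e n * A| + `|e n * B|.
have sphi n : smooth (phi n) by exact: mollifier_smooth.
have cphi n : continuous (phi n) by exact: smooth_continuous.
have supphi n : supported `[- Z n, Z n] (phi n) by exact: supported_mollifier.
have mass n x : \int[mu]_z phi n (z - x) = c n by exact: Rintegral_shift.
have cshift n x : continuous (fun z => phi n (z - x)).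
  by apply: smooth_continuous; exact: smooth_shift.
have ishift n x : mu.-integrable setT (EFin \o (fun z => phi n (z - x))).
  exact: integrable_supported (supported_shift (c := x) (supphi n)).
pose f n x := \int[mu]_z (((c n)^-1 * u z) * phi n (z - (1 - e n) * x)).
have cuc n : continuous (fun z => (c n)^-1 * u z).
  by move=> z; apply: (@continuousM _ _ (cst (c n)^-1) u); [exact: cst_continuous|exact: cu].
exists f; split => [n|n x xAB|x xAB].
- exact: smooth_conv (supphi n).
- rewrite /f (derive1n_conv _ _ (cuc n) (sphi n) (supphi n)).
  under eq_Rintegral do rewrite -mulrA.
  have sm := @smooth_derive1n _ m _ (sphi n).
  rewrite RintegralZl//; last first.
    apply: integrable_conv_kernel (supported_derive1n m (supphi n)) => //.
    exact: smooth_continuous.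
  (* The derivatives in [x] have fallen on the kernel, each with a factor [1 - e n] up to sign;
     testing against the translated kernel trades them for [g]. *)
  have := wug (fun z => phi n (z - (1 - e n) * x)).
  rewrite derive1n_shift => ->; last first.
    split; first exact: smooth_shift.
    exists (`|Z n| + `|(1 - e n) * x|) => y.
    move=> hy; apply: (supported_shift (c := (1 - e n) * x) (supphi n)).
    by rewrite /= in_itv/= -ler_norml; apply/negP; rewrite -ltNge.
  rewrite !normrM !normrX normrN1 expr1n mul1r normrN.
  have := e01 n => /andP[e0 e1].
  apply: (@le_trans _ _ (1 * (`|(c n)^-1| * (M * c n)))).
    apply: ler_pM => //.
    + by apply: exprn_ile1 => //; rewrite ger0_norm; lra.
    + apply: ler_wpM2l => //.
      rewrite -(mass n ((1 - e n) * x)).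
      apply: (@normr_Rintegral_ae_le _ A B) => //.
        by move=> z; exact: mollifier_ge0.
      move=> z zAB; apply/eqP/negPn/negP => h; apply: zAB.
      by have [] := mollifier_near_convex xAB (e01 n) h.
  by rewrite mul1r gtr0_norm ?invr_gt0// mulrC mulfK// gt_eqF.
- apply/cvgrPdist_le => eta eta0.
  have /cvgrPdist_le/(_ _ eta0) := cu x.
  rewrite -filter_from_norm_nbhs => -[d /= d0 hd].
  have dAB : 0 < d / (B - A) by rewrite divr_gt0// subr_gt0.
  near=> n.
  have en : e n * (B - A) < d.
    rewrite -ltr_pdivlMr ?subr_gt0//.
    apply: (@le_lt_trans _ _ n.+1%:R^-1).
      by rewrite lef_pV2 ?posrE ?ltr0n// ler_nat.
    by near: n; exact: (near_infty_natSinv_lt (PosNum dAB)).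
  (* [u x] is itself an average with the same weights, so only [u x - u z] for [z] close to [x] has
     to be small. *)
  have -> : u x = \int[mu]_z ((c n)^-1 * u x * phi n (z - (1 - e n) * x)).
    by rewrite RintegralZl// mass mulrAC mulVf ?mul1r// gt_eqF.
  have icst : mu.-integrable setT
      (EFin \o (fun z => (c n)^-1 * u x * phi n (z - (1 - e n) * x))).
    by apply: (@integrable_conv_kernel (cst ((c n)^-1 * u x)) _ (Z n)) => //; exact: cst_continuous.
  have iu := integrable_conv_kernel ((1 - e n) * x) (cuc n) (cphi n) (supphi n).
  have iB := integrableB measurableT icst iu.
  rewrite /f -RintegralB//.
  apply: le_trans (le_normr_Rintegral _ _) _ => //.
  apply: (@le_trans _ _ (\int[mu]_z ((c n)^-1 * eta * phi n (z - (1 - e n) * x)))).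
    apply: le_Rintegral => //.
    + by exact: (integrable_norm iB).
    + apply: (@integrable_conv_kernel (cst ((c n)^-1 * eta)) _ (Z n)) => //.
      exact: cst_continuous.
    + move=> z _; rewrite -mulrBl -mulrBr -!mulrA normrM gtr0_norm ?invr_gt0//.
      rewrite ler_wpM2l ?invr_ge0 ?(ltW (c0 n))//.
      rewrite normrM [X in _ * X <= _]ger0_norm ?mollifier_ge0//.
      have [->|hz] := eqVneq (phi n (z - (1 - e n) * x)) 0; first by rewrite !mulr0.
      rewrite ler_wpM2r ?mollifier_ge0//; apply: hd => /=.
      have [_ h] := mollifier_near_convex xAB (e01 n) hz.
      by apply: le_lt_trans h _.
  by rewrite RintegralZl// mass mulrAC mulVf ?mul1r// gt_eqF.
Unshelve. all: by end_near. Qed.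

End WeakApprox.

Section Interpolation.
Variable R : realType.
Implicit Types (x y z a b c A B M : R) (f g u : R -> R) (p q : {poly R}) (s : seq R).
Local Notation mu := (@lebesgue_measure R).

Lemma poly_eq_on p q s : uniq s -> (size p <= size s)%N -> (size q <= size s)%N ->
  {in s, forall x, p.[x] = q.[x]} -> p = q.
Proof.
move=> us sp sq pq; apply/eqP; rewrite -subr_eq0; apply/negPn/negP => n0.
have rs : all (root (p - q)) s.
  by apply/allP => x xs; rewrite rootE hornerD hornerN pq// subrr.
have := max_poly_roots n0 rs us.
apply/negP; rewrite -leqNgt (leq_trans (size_polyD _ _))//.
by rewrite geq_max sp size_polyN.
Qed.

Definition lagrange_poly s x : {poly R} :=
  \prod_(y <- rem x s) ((x - y)^-1 *: ('X - y%:P)).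

Lemma size_lagrange_poly s x : x \in s -> (size (lagrange_poly s x) <= size s)%N.
Proof.
move=> xs; rewrite /lagrange_poly.
have -> : size s = (size (rem x s)).+1 by rewrite size_rem// prednK//; case: s xs.
elim: (rem x s) => [|y r IH]; first by rewrite big_nil size_poly1.
rewrite big_cons -scalerAl (leq_trans (size_scale_leq _ _))//.
rewrite (leq_trans (size_polyMleq _ _))// size_XsubC /= ltnS.
exact: IH.
Qed.

Lemma lagrange_poly_sample s x y : uniq s -> x \in s -> y \in s ->
  (lagrange_poly s x).[y] = (x == y)%:R.
Proof.
move=> us xs ys; rewrite /lagrange_poly horner_prod.
under eq_bigr do rewrite hornerZ hornerXsubC.
have [<-{ys y}|xy] := eqVneq x y.
  rewrite big_seq big1// => z; rewrite mem_rem_uniq// inE => /andP[zx _].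
  by rewrite mulVf// subr_eq0 eq_sym.
have yr : y \in rem x s by rewrite mem_rem_uniq// inE eq_sym xy.
by rewrite (big_rem y yr)/= subrr mulr0 mul0r.
Qed.

Definition interpolant f s : {poly R} := \sum_(x <- s) f x *: lagrange_poly s x.

Lemma size_interpolant f s : (size (interpolant f s) <= size s)%N.
Proof.
rewrite /interpolant big_seq; elim/big_ind: _ => [|p q sp sq|x xs].
- by rewrite size_poly0.
- by rewrite (leq_trans (size_polyD _ _))// geq_max sp.
- by rewrite (leq_trans (size_scale_leq _ _))// size_lagrange_poly.
Qed.

Lemma interpolant_sample f s y : uniq s -> y \in s -> (interpolant f s).[y] = f y.
Proof.
move=> us ys; rewrite /interpolant horner_sum (big_rem y ys)/= big_seq big1.
  by rewrite hornerZ lagrange_poly_sample// eqxx mulr1 addr0.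
move=> x; rewrite mem_rem_uniq// inE => /andP[xy xs].
by rewrite hornerZ lagrange_poly_sample// (negbTE xy) mulr0.
Qed.

Lemma derivn_le_size m p x : (size p <= m.+1)%N -> p^`(m).[x] = p`_m *+ m`!.
Proof.
move=> sp; have -> : p^`(m) = (p`_m *+ m`!)%:P.
  apply/polyP => i; rewrite coef_derivn coefC; case: i => [|i] /=.
    by rewrite addn0 ffactnn.
  by rewrite nth_default ?mul0rn// addnS (leq_trans sp)// ltnS leq_addr.
exact: hornerC.
Qed.

Lemma derive1_sub_horner f p : (forall x, derivable f x 1) ->
  derive1 (fun x => f x - p.[x]) = fun x => derive1 f x - p^`().[x].
Proof.
move=> df; apply/funext => x; apply: derive1_is_derive.
by apply: is_deriveB; exact: is_derive_derive1.
Qed.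

Lemma derive1n_sub_horner n f p : smooth f ->
  derive1n n (fun x => f x - p.[x]) = fun x => derive1n n f x - p^`(n).[x].
Proof.
move=> sf; elim: n => [//|n IH].
rewrite !derive1nS {}IH derivnS derive1_sub_horner//.
Qed.

Lemma smooth_sub_horner f p : smooth f -> smooth (fun x => f x - p.[x]).
Proof.
by move=> sf n x; rewrite derive1n_sub_horner//; apply: derivableB => //; exact: sf.
Qed.

(** Stating both sequences as paths from the same [x] carries the order through the induction: each
    new zero lies strictly between two neighbours, hence before the later ones. *)
Lemma rolle_path A B f x s : (forall x, derivable f x 1) -> path <%R x s ->
  {in x :: s, forall y, y \in `[A, B] /\ f y = 0} ->
  exists t, [/\ size t = size s, path <%R x t &
    {in t, forall y, y \in `[A, B] /\ derive1 f y = 0}].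
Proof.
move=> df; elim: s x => [|y s IH] x /=; first by exists [::].
move=> /andP[xy ps] H.
have [|t [st pt Ht]] := IH y ps; first by move=> z zs; apply: H; rewrite inE zs orbT.
have [xAB fx] := H x (mem_head _ _).
have [yAB fy] : y \in `[A, B] /\ f y = 0 by apply: H; rewrite !inE eqxx orbT.
have [|||c cxy fc] := @Rolle _ f x y xy.
- by move=> z _; exact: df.
- by apply: continuous_subspaceT; exact: derivable_continuous.
- by rewrite fx fy.
move: cxy; rewrite in_itv/= => /andP[xc cy].
exists (c :: t); split; first by rewrite /= st.
- rewrite /= xc/=; case: t pt {st Ht} => //= z t /andP[yz ->].
  by rewrite (lt_trans cy).
- move=> z; rewrite inE => /predU1P[->|/Ht//]; split; last exact: derive1_is_derive.
  move: xAB yAB; rewrite !in_itv/= => /andP[Ax _] /andP[_ yB].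
  by rewrite (le_trans Ax (ltW xc)) (le_trans (ltW cy)).
Qed.

Lemma rolle_sorted A B m f s : smooth f -> sorted <%R s -> size s = m.+1 ->
  {in s, forall y, y \in `[A, B] /\ f y = 0} ->
  exists2 y, y \in `[A, B] & derive1n m f y = 0.
Proof.
elim: m f s => [|m IH] f [//|x s] sf.
  by move=> _ _ /(_ x (mem_head _ _))[xAB fx]; exists x.
move=> /= ps [ss] Hs.
have [[|y t] [st pt Ht]] := rolle_path (sf 0%N) ps Hs; rewrite ss in st => //.
move: pt => /= /andP[_ pt].
have [z zAB fz] := IH _ (y :: t) (smooth_derive1 sf) pt st Ht.
by exists z => //; rewrite -[LHS]/(derive1n m.+1 f z) -derive1n_derive1.
Qed.

(** The coefficient of degree [m] is the divided difference of [f] on [s]. Since [f - p] has [m.+1]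
    zeros, its derivative of order [m] vanishes somewhere, and there that of [f] equals [m!] times
    the coefficient. *)
Lemma smooth_lead_coef_le A B M m f p s : smooth f ->
  (forall x, x \in `[A, B] -> `|derive1n m f x| <= M) ->
  uniq s -> size s = m.+1 -> {in s, forall x, x \in `[A, B]} ->
  (size p <= m.+1)%N -> {in s, forall x, p.[x] = f x} ->
  `|p`_m| <= M / m`!%:R.
Proof.
move=> sf fM us ss sAB sp pf.
have [||||y yAB] := @rolle_sorted A B m (fun x => f x - p.[x]) (sort <=%R s).
- exact: smooth_sub_horner.
- by rewrite sort_lt_sorted.
- by rewrite size_sort.
- by move=> y; rewrite mem_sort => ys; rewrite pf// subrr; split => //; exact: sAB.
rewrite derive1n_sub_horner// derivn_le_size// => /eqP; rewrite subr_eq0 => /eqP fy.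
have := fM _ yAB; rewrite fy normrMn => H.
have m0 : 0 < m`!%:R :> R by rewrite ltr0n fact_gt0.
by rewrite ler_pdivlMr// mulr_natr.
Qed.

(** For fixed nodes the coefficient is a fixed linear combination of the nodal values, so pointwise
    convergence of the smooth approximants at the nodes passes the bound on to [u]. *)
Lemma weak_lead_coef_le A B M m u g p s : A < B -> continuous u ->
  is_weak_derivative m u g -> 0 <= M ->
  {ae mu, forall z, z \in `[A, B] -> `|g z| <= M} ->
  uniq s -> size s = m.+1 -> {in s, forall x, x \in `[A, B]} ->
  (size p <= m.+1)%N -> {in s, forall x, p.[x] = u x} ->
  `|p`_m| <= M / m`!%:R.
Proof.
move=> AB cu wg M0 gM us ss sAB sp pu.
have [f [sf fM fu]] := weak_derivative_approx AB cu wg M0 gM.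
have -> : p = interpolant u s.
  apply: (poly_eq_on us); rewrite ?size_interpolant ?ss//.
  by move=> x xs; rewrite interpolant_sample// pu.
have cvgp : (interpolant (f n) s)`_m @[n --> \oo] --> (interpolant u s)`_m.
  rewrite /interpolant.
  have E h : (\sum_(x <- s) h x *: lagrange_poly s x)`_m =
      \sum_(x <- s) h x * (lagrange_poly s x)`_m.
    by rewrite coef_sum; apply: eq_bigr => x _; rewrite coefZ.
  rewrite E; under eq_fun do rewrite E.
  have : {in s, forall x, f n x @[n --> \oo] --> u x} by move=> x /sAB; exact: fu.
  move: (lagrange_poly s) => l; elim: s {us ss sAB pu E} => [|x r IH] fur.
    by rewrite big_nil; under eq_fun do rewrite big_nil; exact: cvg_cst.
  rewrite big_cons.
  rewrite (_ : (fun n => _) = fun n => f n x * (l x)`_m +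
    \sum_(y <- r) f n y * (l y)`_m); last by apply/funext => n; rewrite big_cons.
  apply: cvgD; first by apply: cvgMl; apply: fur; exact: mem_head.
  by apply: IH => y yr; apply: fur; rewrite inE yr orbT.
have le n : `|(interpolant (f n) s)`_m| <= M / m`!%:R.
  apply: (smooth_lead_coef_le (sf n) (fM n) us ss sAB).
    by rewrite -ss size_interpolant.
  by move=> x xs; rewrite interpolant_sample.
rewrite -(cvg_lim (@Rhausdorff R) (cvg_norm cvgp)).
apply: limr_le; first exact: cvgP (cvg_norm cvgp).
by apply: nearW.
Qed.

End Interpolation.

(** * Interpolation error, in values and in derivatives at the ends *)

Section InterpolationError.
Variable R : realType.
Implicit Types (x y z a b c A B M : R) (f g u : R -> R) (p q : {poly R}) (s : seq R).
Local Notation mu := (@lebesgue_measure R).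

(** The difference of two difference quotients at [x0] is [s - t] times a second divided difference,
    hence at most [M |s - t|]; the quotients are therefore Cauchy as the increment tends to 0. *)
Lemma weak_derivable M u g : continuous u -> is_weak_derivative 2 u g -> 0 <= M ->
  {ae mu, forall z, `|g z| <= M} -> forall x, derivable u x 1.
Proof.
move=> cu wg M0 gM x0.
pose D t := t^-1 * (u (t + x0) - u x0).
have lip (s t : R) : s != t -> s != 0 -> t != 0 -> `|s| <= 1 -> `|t| <= 1 ->
    `|D s - D t| <= M * `|s - t|.
  move=> st s0 t0 s1 t1.
  pose l := [:: x0; s + x0; t + x0].
  have ul : uniq l.
    have x0n r : r != 0 -> x0 != r + x0 by move=> r0; rewrite eq_sym -subr_eq0 addrK.
    by rewrite /= !inE negb_or !x0n//= (inj_eq (addIr x0)) st.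
  pose p := interpolant u l.
  have sp : (size p <= 3)%N := size_interpolant u l.
  have pl : {in l, forall y, p.[y] = u y} by move=> y; exact: interpolant_sample.
  have AB : x0 - 1 < x0 + 1 by lra.
  have lAB : {in l, forall y, y \in `[x0 - 1, x0 + 1]}.
    move: s1 t1; rewrite !ler_norml => /andP[? ?] /andP[? ?].
    move=> y yl; rewrite in_itv/=; move: yl; rewrite !inE.
    by move=> /or3P[] /eqP ->; apply/andP; split; lra.
  have gM' : {ae mu, forall z, z \in `[x0 - 1, x0 + 1] -> `|g z| <= M}.
    by move: gM; apply: (@filterS _ _ (ae_filter_ringOfSetsType mu)).
  have := weak_lead_coef_le AB cu wg M0 gM' ul (erefl : size l = 3) lAB sp pl.
  have -> : D s - D t = p`_2 * (s - t).
    have E y : p.[y] = p`_0 + p`_1 * y + p`_2 * y ^+ 2.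
      rewrite (horner_coef_wide _ sp) !big_ord_recl big_ord0/= /bump/=.
      by rewrite expr0 expr1 mulr1 addr0 addrA.
    rewrite /D -!pl ?inE ?eqxx ?orbT// !E.
    by field; rewrite s0 t0.
  move=> pM; rewrite normrM ler_wpM2r//; apply: le_trans pM _.
  by rewrite ler_pdivrMr// ler_peMr// ler1n.
have : cvg (D t @[t --> 0^']).
  apply/cauchy_cvgP/cauchy_exP => e e0.
  (* For [|t| < t0] one has [|t0 - t| < 2 t0], and [2 t0 M < e]; the [+ 1] covers [M = 0]. *)
  pose t0 := Num.min 1 (e / (2 * (M + 1))).
  have M1 : 0 < M + 1 by rewrite ltr_wpDl.
  have t00 : 0 < t0 by rewrite lt_min ltr01 divr_gt0// mulr_gt0.
  exists (D t0); suff : \forall t \near 0^', ball (D t0) e (D t) by []. near=> t.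
  have tn0 : t != 0 by near: t; exact: nbhs_dnbhs_neq.
  have tt0 : `|t| < t0 by near: t; exact: dnbhs0_lt.
  have t01 : t0 <= 1 by rewrite ge_min lexx.
  have tet : t0 <= e / (2 * (M + 1)) by rewrite ge_min lexx orbT.
  rewrite /= -ball_normE /=.
  have [t1 t2] : - t0 < t /\ t < t0 by move: tt0; rewrite ltr_norml => /andP[].
  apply: le_lt_trans (lip t0 t _ _ tn0 _ _) _.
  - by rewrite gt_eqF.
  - by rewrite gt_eqF.
  - by rewrite gtr0_norm.
  - by rewrite (le_trans (ltW tt0)).
  rewrite gtr0_norm ?subr_gt0//.
  apply: (@le_lt_trans _ _ (M * (2 * t0))); first by rewrite ler_wpM2l//; lra.
  move: tet; rewrite ler_pdivlMr ?mulr_gt0//; nra.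
by move=> /cvg_ex[l Dl]; exact: (@ex_derive _ _ _ _ _ _ _ (is_derive_cvg Dl)).
Unshelve. all: by end_near. Qed.

(** The error at [x] is a divided difference on [x :: s] times the product of the distances to the
    nodes. One factor [|x - c|] is kept apart, so that dividing by it bounds the derivative of the
    error at the node [c]. *)
Lemma interpolation_error A B M m u g s x c : A < B -> continuous u ->
  is_weak_derivative m.+1 u g -> 0 <= M ->
  {ae mu, forall z, z \in `[A, B] -> `|g z| <= M} ->
  uniq s -> size s = m.+1 -> {in s, forall x, x \in `[A, B]} ->
  x \in `[A, B] -> c \in s ->
  `|u x - (interpolant u s).[x]| <= M * (B - A) ^+ m * `|x - c|.
Proof.
move=> AB cu wg M0 gM us ss sAB xAB cs.
have MBA : 0 <= M * (B - A) ^+ m by rewrite mulr_ge0// exprn_ge0// subr_ge0 ltW.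
have [xs|xs] := boolP (x \in s).
  by rewrite interpolant_sample// subrr normr0 mulr_ge0.
pose P := interpolant u (x :: s); pose w := \prod_(y <- s) ('X - y%:P).
have uxs : uniq (x :: s) by rewrite /= xs us.
have sP : (size P <= m.+2)%N by rewrite (leq_trans (size_interpolant _ _))//= ss.
have sw : size w = m.+2 by rewrite size_prod_XsubC ss.
have lw : w`_m.+1 = 1.
  have /monicP := monic_prod_XsubC s xpredT id.
  by rewrite lead_coefE size_prod_XsubC ss.
have ws y : y \in s -> w.[y] = 0.
  by move=> ys; apply/eqP; rewrite -rootE root_prod_XsubC.
have Eq : interpolant u s = P - P`_m.+1 *: w.
  apply: (poly_eq_on us).
  - exact: size_interpolant.
  - rewrite ss; apply/leq_sizeP => i; rewrite leq_eqVlt => /predU1P[<-|mi].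
      by rewrite coefB coefZ lw mulr1 subrr.
    by rewrite coefB coefZ [P`_i]nth_default ?(leq_trans sP)// [w`_i]nth_default ?sw// mulr0 subr0.
  - move=> y ys; rewrite hornerD hornerN hornerZ ws// mulr0 subr0.
    by rewrite !interpolant_sample// inE ys orbT.
have PM : `|P`_m.+1| <= M.
  apply: le_trans (@weak_lead_coef_le _ A B M m.+1 u g P (x :: s) _ _ _ _ _ _ _ _ _ _) _ => //.
  - by rewrite /= ss.
  - by move=> y; rewrite inE => /predU1P[->//|]; exact: sAB.
  - by move=> y ys; rewrite interpolant_sample.
  - by rewrite ler_pdivrMr ?ltr0n ?fact_gt0// ler_peMr// ler1n fact_gt0.
rewrite Eq hornerD hornerN hornerZ interpolant_sample ?mem_head//.
rewrite opprB addrC subrK normrM -mulrA; apply: ler_pM => //.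
rewrite /w horner_prod (big_rem c cs)/= hornerXsubC normrM mulrC ler_wpM2r//.
have : {in rem c s, forall y, y \in `[A, B]}.
  by move=> y; rewrite mem_rem_uniq// inE => /andP[_]; exact: sAB.
have -> : m = size (rem c s) by rewrite size_rem// ss.
elim: (rem c s) => [|y r IH] rAB; first by rewrite big_nil expr0 normr1.
rewrite big_cons normrM hornerXsubC /= exprS; apply: ler_pM => //.
  have := rAB y (mem_head _ _); move: xAB; rewrite !in_itv/= ler_norml.
  by move=> /andP[? ?] /andP[? ?]; apply/andP; split; lra.
by apply: IH => z zr; apply: rAB; rewrite inE zr orbT.
Qed.

Lemma derivable_cvg f c : derivable f c 1 ->
  h^-1 * (f (h + c) - f c) @[h --> 0^'] --> derive1 f c.
Proof.
move=> /cvg_ex[l]; under eq_fun do rewrite scaler1.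
by rewrite /derive1 => fl; rewrite (cvg_lim _ fl).
Qed.

(** The estimate is available only inside the cell; as [f] is derivable at [c], the one-sided limit
    of the quotient already gives the derivative. *)
Lemma derive1_norm_le_right f c K e : 0 < e -> derivable f c 1 -> f c = 0 ->
  (forall x, c < x < c + e -> `|f x| <= K * `|x - c|) -> `|derive1 f c| <= K.
Proof.
move=> e0 df fc fK.
have fcv := cvg_dnbhs_at_right (derivable_cvg df); rewrite fc in fcv.
apply: (cvgr_to_le (cvg_norm fcv)); near=> h.
have h0 : 0 < h by near: h; exact: nbhs_right_gt.
have he : h < e by near: h; exact: nbhs_right_lt.
rewrite subr0 normrM normfV mulrC ler_pdivrMr ?normr_gt0 ?gt_eqF//.
apply: le_trans (fK (h + c) _) _; first by apply/andP; split; lra.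
by rewrite addrK.
Unshelve. all: by end_near. Qed.

Lemma derive1_norm_le_left f c K e : 0 < e -> derivable f c 1 -> f c = 0 ->
  (forall x, c - e < x < c -> `|f x| <= K * `|x - c|) -> `|derive1 f c| <= K.
Proof.
move=> e0 df fc fK.
have fcv := cvg_dnbhs_at_left (derivable_cvg df); rewrite fc in fcv.
apply: (cvgr_to_le (cvg_norm fcv)); near=> h.
have h0 : h < 0 by near: h; exact: nbhs_left_lt.
have he : - e < h by near: h; apply: nbhs_left_gt; rewrite oppr_lt0.
rewrite subr0 normrM normfV mulrC ler_pdivrMr ?normr_gt0 ?lt_eqF//.
apply: le_trans (fK (h + c) _) _; first by apply/andP; split; lra.
by rewrite addrK.
Unshelve. all: by end_near. Qed.

(** The nodes are equidistant and include both ends, which needs [k > 0]: end values are then exact,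
    and the error near an end is at most [M h^k] times the distance to it. *)
Lemma cell_interpolant k xL h M u g : (0 < k)%N -> 0 < h -> continuous u ->
  is_weak_derivative k.+1 u g -> 0 <= M ->
  {ae mu, forall z, z \in `[xL, xL + h] -> `|g z| <= M} ->
  derivable u xL 1 -> derivable u (xL + h) 1 ->
  exists p, [/\ (size p <= k.+1)%N, p.[xL] = u xL /\ p.[xL + h] = u (xL + h),
    forall x, x \in `[xL, xL + h] -> `|u x - p.[x]| <= M * h ^+ k.+1,
    `|derive1 u xL - p^`().[xL]| <= M * h ^+ k &
    `|derive1 u (xL + h) - p^`().[xL + h]| <= M * h ^+ k].
Proof.
move=> k0 h0 cu wg M0 gM dL dR.
pose s := [seq xL + i%:R / k%:R * h | i <- iota 0 k.+1].
have kn0 : k%:R != 0 :> R by rewrite pnatr_eq0 -lt0n.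
have kp : 0 < k%:R :> R by rewrite ltr0n.
have us : uniq s.
  rewrite map_inj_uniq ?iota_uniq// => i j /addrI.
  have hn0 : h != 0 by rewrite gt_eqF.
  by move/(mulIf hn0)/(mulIf (invr_neq0 kn0))/eqP; rewrite eqr_nat => /eqP.
have ss : size s = k.+1 by rewrite size_map size_iota.
have sAB : {in s, forall x, x \in `[xL, xL + h]}.
  move=> x /mapP[i]; rewrite mem_iota add0n ltnS => /andP[_ ik] ->.
  rewrite in_itv/=; have i0 : 0 <= i%:R / k%:R * h.
    by rewrite mulr_ge0 ?divr_ge0 ?ler0n// ltW.
  have i1 : i%:R / k%:R * h <= 1 * h.
    by rewrite ler_wpM2r ?(ltW h0)// ler_pdivrMr// mul1r ler_nat.
  by apply/andP; split; lra.
have Ls : xL \in s.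
  by apply/mapP; exists 0%N; rewrite ?mem_iota//= !mul0r addr0.
have Rs : xL + h \in s.
  by apply/mapP; exists k; rewrite ?mem_iota//= ?ltnS ?leqnn// divff// mul1r.
pose p := interpolant u s.
have hAB : xL < xL + h by rewrite ltrDl.
have err x c : x \in `[xL, xL + h] -> c \in s ->
    `|u x - p.[x]| <= M * h ^+ k * `|x - c|.
  move=> xAB cs; have := interpolation_error hAB cu wg M0 gM us ss sAB xAB cs.
  by rewrite addrAC subrr add0r.
have dp c : derivable u c 1 -> derivable (fun x => u x - p.[x]) c 1.
  by move=> du; apply: derivableB => //; exact: derivable_horner.
have d1 c : derivable u c 1 ->
    derive1 u c - p^`().[c] = derive1 (fun x => u x - p.[x]) c.
  move=> du; apply/esym/derive1_is_derive.
  by apply: is_deriveB; exact: is_derive_derive1.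
exists p; split.
- by rewrite -ss size_interpolant.
- by rewrite !interpolant_sample.
- move=> x xAB; apply: le_trans (err x xL xAB Ls) _.
  rewrite exprSr mulrA ler_wpM2l ?mulr_ge0 ?exprn_ge0 ?(ltW h0)//.
  by move: xAB; rewrite in_itv/= ler_norml => /andP[? ?]; apply/andP; split; lra.
- rewrite d1//; apply: (derive1_norm_le_right h0 (dp _ dL)).
    by rewrite interpolant_sample// subrr.
  by move=> x /andP[x1 x2]; apply: err => //; rewrite in_itv/= !ltW.
- rewrite d1//; apply: (derive1_norm_le_left h0 (dp _ dR)).
    by rewrite interpolant_sample// subrr.
  by move=> x /andP[x1 x2]; apply: err => //; rewrite in_itv/= !ltW//; lra.
Qed.

End InterpolationError.

(** * Legendre polynomials on [0, 1] *)

Section Legendre.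
Variable R : realType.
Implicit Types (x y z a b c : R) (p q v g e : {poly R}) (n m i j k : nat).

(** At [i = 0] the division by [0%:R] returns 0, so the constant term vanishes. *)
Definition primitive p : {poly R} := \poly_(i < (size p).+1) (p`_i.-1 / i%:R).

Lemma deriv_primitive p : (primitive p)^`() = p.
Proof.
apply/polyP => i; rewrite coef_deriv coef_poly ltnS /=.
case: ltnP => [ip|pi]; last by rewrite mul0rn nth_default.
by rewrite -[LHS]mulr_natr divfK// pnatr_eq0.
Qed.

(** Kept algebraic so that the Legendre computations stay among polynomials; [Rintegral_cell] links
    it to the Lebesgue integral. *)
Definition integral01 p : R := (primitive p).[1] - (primitive p).[0].

Lemma integral01_deriv p : integral01 p^`() = p.[1] - p.[0].
Proof.
have : (primitive p^`() - p)^`() = 0 by rewrite derivB deriv_primitive subrr.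
set q := primitive p^`() - p => dq.
have qE : q = (q`_0)%:P.
  apply/polyP => -[|i]; rewrite coefC//=.
  have := coef_deriv q i; rewrite dq coef0 => /esym/eqP.
  by rewrite mulrn_eq0/= => /eqP.
have Ep : primitive p^`() = q + p by rewrite subrK.
clearbody q; by rewrite /integral01 Ep !hornerD qE !hornerC; ring.
Qed.

Lemma integral01D p q : integral01 (p + q) = integral01 p + integral01 q.
Proof.
rewrite -{1}(deriv_primitive p) -{1}(deriv_primitive q) -derivD integral01_deriv.
by rewrite !hornerD /integral01; ring.
Qed.

Lemma integral01Z c p : integral01 (c *: p) = c * integral01 p.
Proof.
rewrite -{1}(deriv_primitive p) -derivZ integral01_deriv !hornerZ /integral01.
by ring.
Qed.

Lemma integral010 : integral01 0 = 0.
Proof. by rewrite -(scale0r 0) integral01Z mul0r. Qed.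

Lemma integral01MDZ p q v c :
  integral01 ((p + c *: q) * v) = integral01 (p * v) + c * integral01 (q * v).
Proof. by rewrite [X in integral01 X]mulrDl integral01D -scalerAl integral01Z. Qed.

Lemma integral01_by_parts p v : integral01 (p^`() * v) =
  p.[1] * v.[1] - p.[0] * v.[0] - integral01 (p * v^`()).
Proof.
have := integral01_deriv (p * v); rewrite derivM integral01D !hornerM => <-.
by ring.
Qed.

Lemma poly_cst_on01 p c : (forall x, 0 <= x <= 1 -> p.[x] = c) -> p = c%:P.
Proof.
move=> pc; set n := (size p).+1.
have nn0 : n%:R != 0 :> R by rewrite pnatr_eq0.
have us : uniq [seq i%:R / n%:R : R | i <- iota 0 n].
  rewrite map_inj_uniq ?iota_uniq// => i j /(mulIf (invr_neq0 nn0))/eqP.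
  by rewrite eqr_nat => /eqP.
apply: (poly_eq_on us).
- by rewrite size_map size_iota.
- by rewrite size_map size_iota (leq_trans (size_polyC_leq1 _)).
move=> x /mapP[i]; rewrite mem_iota add0n => /andP[_ lin] ->.
rewrite hornerC pc// divr_ge0 ?ler0n//= ler_pdivrMr ?ltr0n// mul1r ler_nat.
exact: ltnW.
Qed.

(** A primitive of [p * p] is nondecreasing; equal values at 0 and 1 would make it constant on the
    interval, hence a constant polynomial, and [p] would be 0. *)
Lemma integral01_sqr_gt0 p : p != 0 -> 0 < integral01 (p * p).
Proof.
move=> p0; set P := primitive (p * p).
have mono x y : x <= y -> P.[x] <= P.[y].
  rewrite le_eqVlt => /predU1P[->//|xy].
  have [||c _] := @MVT _ (horner P) (fun x => (p * p).[x]) x y xy.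
  - by move=> z _; have := is_derive_poly P z; rewrite /P deriv_primitive.
  - by apply: continuous_subspaceT => z; exact: continuous_horner.
  move=> /eqP; rewrite -subr_ge0 => /eqP ->.
  by rewrite mulr_ge0 ?subr_ge0 ?(ltW xy)// hornerM -expr2 sqr_ge0.
rewrite lt_neqAle subr_ge0 mono// andbT eq_sym subr_eq0.
apply: contra p0 => /eqP P01.
have : P = P.[0]%:P.
  apply: poly_cst_on01 => x /andP[x0 x1]; apply/le_anti.
  by rewrite [P.[0] <= _]mono// andbT -P01 mono.
move=> /(congr1 (@deriv R)); rewrite derivC deriv_primitive => /eqP.
by rewrite mulf_eq0 orbb.
Qed.

Lemma deriv_XsubC_expM c n g : (('X - c%:P) ^+ n.+1 * g)^`() =
  ('X - c%:P) ^+ n * (n.+1%:R *: g + ('X - c%:P) * g^`()).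
Proof.
rewrite derivM deriv_exp derivXsubC mul1r /= exprS mulrDr.
rewrite -scaler_nat -!scalerAl -scalerAr; congr (_ + _).
by rewrite -mulrA mulrCA.
Qed.

Lemma derivn_XsubC_root c j n g : (j < n)%N -> (('X - c%:P) ^+ n * g)^`(j).[c] = 0.
Proof.
elim: j n g => [|j IH] [//|n] g jn.
  by rewrite derivn0 exprS !hornerM hornerXsubC subrr !mul0r.
by rewrite derivSn deriv_XsubC_expM IH.
Qed.

Lemma derivn_XsubC_horner c n g : (('X - c%:P) ^+ n * g)^`(n).[c] = n`!%:R * g.[c].
Proof.
elim: n g => [|n IH] g; first by rewrite derivn0 expr0 !mul1r.
rewrite derivSn deriv_XsubC_expM IH hornerD hornerZ hornerM hornerXsubC subrr.
by rewrite mul0r addr0 factS mulnC natrM mulrA.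
Qed.

Lemma derivnS_XsubC_horner c n g :
  (('X - c%:P) ^+ n * g)^`(n.+1).[c] = n.+1`!%:R * g^`().[c].
Proof.
elim: n g => [|n IH] g; first by rewrite derivn1 expr0 !mul1r.
rewrite derivSn deriv_XsubC_expM IH derivD derivZ derivM derivXsubC mul1r.
rewrite !hornerD hornerZ hornerM hornerXsubC subrr mul0r addr0.
rewrite [n.+2`!]factS natrM -[n.+2%:R]natr1; ring.
Qed.

(** Rodrigues' formula for the Legendre polynomials shifted to [0, 1]. Writing ['X - 0%:P] lets the
    lemmas on powers of ['X - c%:P] serve both ends. *)
Definition legendre n : {poly R} :=
  (n`!%:R)^-1 *: (('X - 0%:P) ^+ n * ('X - 1%:P) ^+ n)^`(n).

Lemma fact_neq0 n : n`!%:R != 0 :> R.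
Proof. by rewrite pnatr_eq0 -lt0n fact_gt0. Qed.

Lemma legendre_1 n : (legendre n).[1] = 1.
Proof.
rewrite /legendre hornerZ mulrC [_ ^+ n * _]mulrC derivn_XsubC_horner.
by rewrite horner_exp hornerXsubC subr0 expr1n mulr1 divff// fact_neq0.
Qed.

Lemma legendre_0 n : (legendre n).[0] = (-1) ^+ n.
Proof.
rewrite /legendre hornerZ derivn_XsubC_horner mulKf ?fact_neq0//.
by rewrite horner_exp hornerXsubC sub0r.
Qed.

(** For [n = k - 1] and [n = k] these are the numbers [k (k - 1)] and [k (k + 1)] of the interface
    relations. *)
Lemma deriv_legendre_1 n : (legendre n)^`().[1] = n%:R * (n%:R + 1).
Proof.
rewrite /legendre derivZ hornerZ [_ ^+ n * _]mulrC -derivnS derivnS_XsubC_horner.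
rewrite deriv_exp derivXsubC mul1r hornerMn horner_exp hornerXsubC subr0 expr1n.
by rewrite factS natrM -[n.+1%:R]natr1; field; exact: fact_neq0.
Qed.

Lemma deriv_legendre_0 n : (legendre n)^`().[0] = - (-1) ^+ n * (n%:R * (n%:R + 1)).
Proof.
rewrite /legendre derivZ hornerZ -derivnS derivnS_XsubC_horner.
rewrite deriv_exp derivXsubC mul1r hornerMn horner_exp hornerXsubC sub0r.
rewrite factS natrM -[n.+1%:R]natr1 -mulr_natr.
have := fact_neq0 n; case: n => [|n] fn0; first by rewrite !(mulr0, mul0r).
rewrite /= [in RHS]exprS; move: (_ ^+ n) => s; field; exact: fn0.
Qed.

Lemma size_legendre_le n : (size (legendre n) <= n.+1)%N.
Proof.
apply: leq_trans (size_scale_leq _ _) _; apply/leq_sizeP => i ni.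
rewrite coef_derivn nth_default ?mul0rn//.
rewrite (leq_trans (size_polyMleq _ _))// !size_exp_XsubC addnS /=.
by rewrite addSnnS leq_add2l.
Qed.

Lemma legendre_lead_neq0 n : (legendre n)`_n != 0.
Proof.
rewrite coefZ coef_derivn mulf_neq0 ?invr_neq0 ?fact_neq0//.
set W := _ * _; have sW : size W = (n + n).+1.
  rewrite size_Mmonic ?monic_neq0 ?monic_exp ?monicXsubC//.
  by rewrite !size_exp_XsubC addnS.
have mW : W \is monic by rewrite monicMr ?monic_exp ?monicXsubC.
have -> : W`_(n + n) = 1 by move/monicP: mW; rewrite lead_coefE sW.
by rewrite pnatr_eq0 -lt0n ffact_gt0 leq_addr.
Qed.

Lemma legendre_neq0 n : legendre n != 0.
Proof. by apply: contraNneq (legendre_lead_neq0 n) => ->; rewrite coef0. Qed.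

Lemma legendre_orth n v : (size v <= n)%N -> integral01 (legendre n * v) = 0.
Proof.
rewrite /legendre -scalerAl integral01Z => sv.
apply/eqP; rewrite mulf_eq0; apply/orP; right; apply/eqP.
set W := (_ ^+ n * _ ^+ n).
have W0 j : (j < n)%N -> W^`(j).[0] = 0 by move=> jn; exact: derivn_XsubC_root.
have W1 j : (j < n)%N -> W^`(j).[1] = 0.
  by rewrite /W mulrC; exact: derivn_XsubC_root.
(* Each integration by parts lowers the order of the derivative of [W] and the size of the test
   polynomial together, and the boundary terms vanish since [W] has zeros of order [n] at both
   ends. *)
suff H j : (j <= n)%N -> forall v, (size v <= j)%N -> integral01 (W^`(j) * v) = 0.
  exact: H.
elim: j {v sv} => [|j IH] jn v sv.
  by move: sv; rewrite leqn0 size_poly_eq0 => /eqP ->; rewrite mulr0 integral010.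
have sv' : (size v^`() <= j)%N.
  have [->|v0] := eqVneq v 0; first by rewrite deriv0 size_poly0.
  by rewrite -ltnS (leq_trans (lt_size_deriv v0)).
have := integral01_by_parts W^`(j) v; rewrite -derivnS => ->.
by rewrite (W0 _ jn) (W1 _ jn) !mul0r (IH (ltnW jn) _ sv') !subr0.
Qed.

Definition legendre_coef e i : R :=
  integral01 (e * legendre i) / integral01 (legendre i * legendre i).

Lemma legendre_expansion n e : (size e <= n)%N ->
  e = \sum_(i < n) legendre_coef e i *: legendre i.
Proof.
elim: n e => [|n IH] e se.
  by move: se; rewrite leqn0 size_poly_eq0 big_ord0 => /eqP.
set c := e`_n / (legendre n)`_n; set e' := e - c *: legendre n.
have se' : (size e' <= n)%N.
  apply/leq_sizeP => j; rewrite leq_eqVlt => /predU1P[<-|nj].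
    by rewrite coefB coefZ divfK ?subrr// legendre_lead_neq0.
  rewrite coefB coefZ nth_default ?(leq_trans se)//.
  by rewrite nth_default ?mulr0 ?subrr// (leq_trans (size_legendre_le n)).
have E : e = e' + c *: legendre n by rewrite subrK.
clearbody e' c.
rewrite big_ord_recr/= {1}E; congr (_ + _).
  rewrite {1}(IH _ se'); apply: eq_bigr => i _; congr (_ *: _).
  rewrite /legendre_coef [in RHS]E integral01MDZ.
  rewrite (@legendre_orth n (legendre i)) ?mulr0 ?addr0//.
  by rewrite (leq_trans (size_legendre_le i)).
congr (_ *: _); rewrite /legendre_coef E integral01MDZ [e' * _]mulrC.
rewrite (@legendre_orth n e')// add0r mulfK// gt_eqF//.
exact: integral01_sqr_gt0 (legendre_neq0 n).
Qed.

Lemma horner_bounded01 p : exists2 C : R, 0 <= C & forall x, 0 <= x <= 1 -> `|p.[x]| <= C.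
Proof.
have [|C C0 HC] := @continuous_bounded_itv R 0 1 (horner p).
  by move=> z; exact: continuous_horner.
by exists C => // x x01; apply: HC; rewrite in_itv.
Qed.

(** A single [K] for values, derivatives and inverse squared norms; it depends on the degree alone
    and feeds the final constant. *)
Lemma legendre_bound n : exists2 K : R, 1 <= K & forall i, (i <= n)%N ->
  [/\ forall x, 0 <= x <= 1 -> `|(legendre i).[x]| <= K,
      forall x, 0 <= x <= 1 -> `|(legendre i)^`().[x]| <= K &
      (integral01 (legendre i * legendre i))^-1 <= K].
Proof.
elim: n => [|n [K K1 IH]]; last first.
  have [C C0 HC] := horner_bounded01 (legendre n.+1).
  have [D D0 HD] := horner_bounded01 (legendre n.+1)^`().
  set E := (integral01 (legendre n.+1 * legendre n.+1))^-1.
  have E0 : 0 <= E by rewrite invr_ge0 ltW// integral01_sqr_gt0 ?legendre_neq0.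
  exists (K + C + D + E); first by lra.
  move=> i; rewrite leq_eqVlt => /predU1P[->|/IH[H1 H2 H3]]; split.
  - by move=> x /HC ?; lra.
  - by move=> x /HD ?; lra.
  - by rewrite -/E; lra.
  - by move=> x /H1 ?; lra.
  - by move=> x /H2 ?; lra.
  - by lra.
have [C C0 HC] := horner_bounded01 (legendre 0).
have [D D0 HD] := horner_bounded01 (legendre 0)^`().
set E := (integral01 (legendre 0 * legendre 0))^-1.
have E0 : 0 <= E by rewrite invr_ge0 ltW// integral01_sqr_gt0 ?legendre_neq0.
exists (1 + C + D + E); first by lra.
move=> i; rewrite leqn0 => /eqP ->; split.
- by move=> x /HC ?; lra.
- by move=> x /HD ?; lra.
- by rewrite -/E; lra.
Qed.

End Legendre.
Arguments legendre {R} n.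

(** * Moments on a cell in reference coordinates *)

Section CellMoments.
Variable R : realType.
Implicit Types (x y z a b c h B K : R) (u : R -> R) (p q r v f e : {poly R}) (n m i j k : nat).
Local Notation mu := (@lebesgue_measure R).

Definition from_ref xL h e : {poly R} := e \Po (h^-1 *: ('X - xL%:P)).
Definition to_ref xL h e : {poly R} := e \Po (xL%:P + h *: 'X).

Lemma horner_from_ref xL h e x : (from_ref xL h e).[x] = e.[(x - xL) / h].
Proof. by rewrite horner_comp hornerZ hornerXsubC mulrC. Qed.

Lemma horner_to_ref xL h e x : (to_ref xL h e).[x] = e.[xL + h * x].
Proof. by rewrite horner_comp hornerD hornerC hornerZ hornerX. Qed.

Lemma deriv_to_ref xL h e x : (to_ref xL h e)^`().[x] = h * e^`().[xL + h * x].
Proof.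
rewrite deriv_comp derivD derivC derivZ derivX add0r hornerM horner_comp.
by rewrite hornerD hornerC !hornerZ hornerX hornerC mulr1 mulrC.
Qed.

Lemma horner_to_ref_inv xL h e x : h != 0 -> e.[x] = (to_ref xL h e).[(x - xL) / h].
Proof. by move=> h0; rewrite horner_to_ref mulrC divfK// addrC subrK. Qed.

Lemma size_comp_affine e r : (size r <= 2)%N -> (size (e \Po r) <= size e)%N.
Proof.
move=> sr; have [->|e0] := eqVneq e 0; first by rewrite comp_poly0.
apply: leq_trans (size_comp_poly_leq _ _) _.
rewrite -[leqRHS]prednK ?size_poly_gt0// ltnS -[leqRHS]muln1 leq_mul2l.
by apply/orP; right; case: (size r) sr => [|[|[]]].
Qed.

Lemma size_from_ref xL h e : (size (from_ref xL h e) <= size e)%N.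
Proof.
by apply: size_comp_affine; rewrite (leq_trans (size_scale_leq _ _))// size_XsubC.
Qed.

Lemma size_to_ref xL h e : (size (to_ref xL h e) <= size e)%N.
Proof.
apply: size_comp_affine; rewrite (leq_trans (size_polyD _ _))// geq_max.
rewrite (leq_trans (size_polyC_leq1 _))//=.
by rewrite (leq_trans (size_scale_leq _ _))// size_polyX.
Qed.

Lemma Rintegral_cell xL h f : 0 < h ->
  \int[mu]_(x in `]xL, xL + h[) (from_ref xL h f).[x] = h * integral01 f.
Proof.
move=> h0; have hn0 : h != 0 by rewrite gt_eqF.
set F := h *: from_ref xL h (primitive f).
have dF : F^`() = from_ref xL h f.
  rewrite derivZ deriv_comp deriv_primitive derivZ derivXsubC -scalerAr mulr1.
  by rewrite scalerA divff// scale1r.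
have ci := continuous_integrable_itv xL (xL + h) (@continuous_horner _ (from_ref xL h f)).
rewrite Rintegral_itv_bndo_bndc; last by apply: integrableS ci => //; exact: subset_itv_oo_cc.
rewrite Rintegral_itv_obnd_cbnd; last by apply: integrableS ci => //; exact: subset_itv_oc_cc.
rewrite /Rintegral (@continuous_FTC2 _ _ (horner F)) ?ltrDl//.
- rewrite /= !hornerZ !horner_from_ref subrr mul0r.
  by rewrite addrAC subrr add0r divff// -mulrBr.
- by apply: continuous_subspaceT; exact: continuous_horner.
- split; first by move=> x _; exact: derivable_horner.
  + by apply: cvg_at_right_filter; exact: continuous_horner.
  + by apply: cvg_at_left_filter; exact: continuous_horner.
- by move=> x _; rewrite -dF; apply: derive1_is_derive.
Qed.

(** Against low degrees [q - p] has the same moments as [u - p], which is at most [B]. One factor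
    [K] bounds the Legendre polynomial, the other its normalisation. *)
Lemma moment_bound n xL h B K u p q : 0 < h -> 0 <= B -> continuous u ->
  (forall v, (size v <= n)%N ->
    \int[mu]_(x in `]xL, xL + h[) (q.[x] * v.[x]) =
    \int[mu]_(x in `]xL, xL + h[) (u x * v.[x])) ->
  (forall x, x \in `[xL, xL + h] -> `|u x - p.[x]| <= B) ->
  (forall i, (i < n)%N -> (forall x, 0 <= x <= 1 -> `|(@legendre R i).[x]| <= K) /\
     (integral01 (@legendre R i * legendre i))^-1 <= K) ->
  forall i, (i < n)%N -> `|legendre_coef (to_ref xL h (q - p)) i| <= B * K * K.
Proof.
move=> h0 B0 cu mom up HK i ilt.
have [HL HI] := HK i ilt.
have K0 : 0 <= K by apply: le_trans (HL 0 _); rewrite ?lexx ?ler01.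
have hn0 : h != 0 by rewrite gt_eqF.
set e := to_ref xL h (q - p); set v := from_ref xL h (legendre i).
have sv : (size v <= n)%N.
  by rewrite (leq_trans (size_from_ref _ _ _))// (leq_trans (size_legendre_le _ _)).
have I0 : 0 < integral01 (@legendre R i * legendre i).
  by rewrite integral01_sqr_gt0 ?legendre_neq0.
have int (f : R -> R) : continuous f -> mu.-integrable `]xL, xL + h[ (EFin \o f).
  move=> cf; apply: integrableS (continuous_integrable_itv xL (xL + h) cf) => //.
  exact: subset_itv_oo_cc.
have cM (f g : R -> R) : continuous f -> continuous g -> continuous (fun x => f x * g x).
  by move=> cf cg x; apply: continuousM; [exact: cf|exact: cg].
have cp r : continuous (horner r) by exact: (@continuous_horner R r).
have key : h * integral01 (e * legendre i) =
    \int[mu]_(x in `]xL, xL + h[) ((u x - p.[x]) * v.[x]).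
  rewrite -(Rintegral_cell xL)//.
  transitivity (\int[mu]_(x in `]xL, xL + h[) (q.[x] * v.[x] - p.[x] * v.[x])).
    apply: eq_Rintegral => x _.
    rewrite horner_from_ref hornerM -(horner_to_ref_inv xL _ _ hn0) hornerD hornerN.
    by rewrite /v horner_from_ref mulrBl.
  rewrite RintegralB//; try by apply: int; apply: cM.
  rewrite mom// -RintegralB//; try by apply: int; apply: cM.
  by apply: eq_Rintegral => x _; rewrite mulrBl.
have cup : continuous (fun x => (u x - p.[x]) * v.[x]).
  by apply: cM => // x; apply: continuousB; [exact: cu|exact: cp].
have bound : `|h * integral01 (e * legendre i)| <= h * (B * K).
  rewrite key; apply: le_trans (le_normr_Rintegral _ (int _ cup)) _ => //.
  have -> : h * (B * K) = \int[mu]_(x in `]xL, xL + h[) (B * K).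
    have hE : h = fine (mu `]xL, xL + h[).
      by rewrite lebesgue_measure_itv/= lte_fin ltrDl h0/= addrAC subrr add0r.
    by rewrite Rintegral_cst// -hE mulrC.
  apply: le_Rintegral => //.
  - by apply: integrable_norm; exact: int.
  - by apply: int; exact: cst_continuous.
  - move=> x /=; rewrite in_itv/= => /andP[x1 x2]; rewrite normrM; apply: ler_pM => //.
      by apply: up; rewrite in_itv/= !ltW.
    rewrite /v horner_from_ref; apply: HL.
    by rewrite ler_pdivrMr// mul1r divr_ge0 ?subr_ge0 ?(ltW h0) ?(ltW x1)//= lerBlDl ltW.
rewrite normrM gtr0_norm// ler_pM2l// in bound.
rewrite /legendre_coef normrM normfV (gtr0_norm I0); apply: ler_pM => //.
by rewrite invr_ge0 ltW.
Qed.

End CellMoments.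

(** * The recurrence between adjacent cells *)

Section InducedNorm.
Variable R : realType.
Implicit Types (X : R) (m n : nat).

Lemma mx_entry_le m n (A : 'M[R]_(m, n)) i j : `|A i j| <= `|A|.
Proof.
rewrite [leRHS]/Num.norm/= mx_normrE.
exact: (@le_bigmax _ _ _ 0 (fun ij => `|A ij.1 ij.2|) (i, j)).
Qed.

Lemma mx_norm_le m n (A : 'M[R]_(m, n)) X : 0 <= X ->
  (forall i j, `|A i j| <= X) -> `|A| <= X.
Proof.
move=> X0 AX; rewrite [leLHS]/Num.norm/= mx_normrE.
by apply: bigmax_le => // ij _; exact: AX.
Qed.

(** A crude bound, used to show that the set whose [sup] is the induced norm is bounded. *)
Lemma mulmx_cV_norm_le m n (A : 'M[R]_(m, n)) (x : 'cV[R]_n) X : `|x| <= X ->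
  `|A *m x| <= `|A| * X * n%:R.
Proof.
move=> xX; have X0 := le_trans (normr_ge0 _) xX.
apply: mx_norm_le => [|i j]; first by rewrite !mulr_ge0.
rewrite mxE; apply: le_trans (ler_norm_sum _ _ _) _.
rewrite -[X in _ <= _ * X%:R]card_ord mulr_natr -sumr_const; apply: ler_sum => l _.
rewrite normrM; apply: ler_pM => //; first exact: mx_entry_le.
by apply: le_trans xX; exact: mx_entry_le.
Qed.

Lemma induced_norm_ge n (A : 'M[R]_n) (x : 'cV[R]_n) X : `|x| <= X ->
  `|A *m x| <= induced_norm A * X.
Proof.
move=> xX; have X0 := le_trans (normr_ge0 _) xX.
have unit (y : 'cV[R]_n) : `|y| <= 1 -> `|A *m y| <= induced_norm A.
  move=> y1; apply: ub_le_sup; last by exists y.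
  exists (`|A| * 1 * n%:R) => _ [z z1 <-].
  exact: mulmx_cV_norm_le.
move: X0; rewrite le_eqVlt => /predU1P[X0|X0].
  move: xX; rewrite -X0 normr_le0 => /eqP ->.
  by rewrite mulmx0 normr0 mulr0.
rewrite -ler_pdivrMr// mulrC -[X^-1]ger0_norm ?invr_ge0 ?(ltW X0)// -normrZ scalemxAr.
apply: unit; rewrite normrZ ger0_norm ?invr_ge0 ?(ltW X0)//.
by rewrite mulrC ler_pdivrMr// mul1r.
Qed.

Lemma induced_norm_ge0 n (A : 'M[R]_n) : 0 <= induced_norm A.
Proof.
have := @induced_norm_ge n A 0 1; rewrite normr0 mulmx0 normr0 mulr1; exact.
Qed.

Lemma mx22_norm_ge (a00 a01 a10 a11 x0 x1 X : R) : `|x0| <= X -> `|x1| <= X ->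
  `|a00 * x0 + a01 * x1| <= induced_norm (mx22 a00 a01 a10 a11) * X /\
  `|a10 * x0 + a11 * x1| <= induced_norm (mx22 a00 a01 a10 a11) * X.
Proof.
move=> x0X x1X; have X0 := le_trans (normr_ge0 _) x0X.
have cX : `|cv2 x0 x1| <= X.
  by apply: mx_norm_le => // i j; rewrite mxE; case: ifP.
have H := induced_norm_ge (mx22 a00 a01 a10 a11) cX.
split; apply: le_trans H.
  have := mx_entry_le (mx22 a00 a01 a10 a11 *m cv2 x0 x1) 0 0.
  by rewrite mxE !big_ord_recl big_ord0 !mxE/= addr0.
have := mx_entry_le (mx22 a00 a01 a10 a11 *m cv2 x0 x1) 1 0.
by rewrite mxE !big_ord_recl big_ord0 !mxE/= addr0.
Qed.

End InducedNorm.

(** * Alternating recurrences over an odd period *)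

Section AlternatingRecurrence.
Variable R : realType.
Implicit Types (N j l : nat) (z f : nat -> R) (F rho nu c p q : R).

(** After [l] steps [z] is [(-1)^l] times its start up to [l F]. A full odd period returns the start
    with the opposite sign, so [2 z_j] is at most [N F]. *)
Lemma alternating_bound N z f F : odd N -> (forall j, z (j + N)%N = z j) ->
  (forall j, z j + z j.+1 = f j) -> (forall j, `|f j| <= F) ->
  forall j, `|z j| <= N%:R / 2 * F.
Proof.
move=> oN pz zf fF j.
have H l : `|z (j + l)%N - (-1) ^+ l * z j| <= l%:R * F.
  elim: l => [|l IH]; first by rewrite addn0 expr0 mul1r subrr normr0 mul0r.
  have -> : z (j + l.+1)%N - (-1) ^+ l.+1 * z j =
      f (j + l)%N - (z (j + l)%N - (-1) ^+ l * z j).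
    by rewrite addnS -zf exprS; ring.
  apply: le_trans (ler_normB _ _) _; rewrite -natr1 mulrDl mul1r addrC.
  exact: lerD.
have := H N; rewrite pz -signr_odd oN expr1 mulN1r opprK -mulr2n normrMn.
by rewrite mulr2n; lra.
Qed.

(* The recurrence reads [x_j + (I + n) x_{j+1} = r_j] with [n ^ 2 = 0]:
   applying [n] kills the nilpotent part, so both [n x] and then [x] solve
   alternating scalar recurrences. *)
Lemma nilpotent_recurrence_bound N (x1 x2 r1 r2 : nat -> R) c p q rho nu :
  odd N -> (forall j, x1 (j + N)%N = x1 j) -> (forall j, x2 (j + N)%N = x2 j) ->
  c ^+ 2 + p * q = 0 ->
  (forall a b X, `|a| <= X -> `|b| <= X -> `|c * a + p * b| <= nu * X /\
    `|q * a - c * b| <= nu * X) ->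
  (forall j, x1 j + x1 j.+1 + (c * x1 j.+1 + p * x2 j.+1) = r1 j) ->
  (forall j, x2 j + x2 j.+1 + (q * x1 j.+1 - c * x2 j.+1) = r2 j) ->
  (forall j, `|r1 j| <= rho) -> (forall j, `|r2 j| <= rho) ->
  forall j, `|x1 j| <= N%:R / 2 * (rho + N%:R / 2 * (nu * rho)) /\
            `|x2 j| <= N%:R / 2 * (rho + N%:R / 2 * (nu * rho)).
Proof.
move=> oN p1 p2 nil nuX e1 e2 r1b r2b.
have y1b := @alternating_bound N (fun j => c * x1 j + p * x2 j)
  (fun j => c * r1 j + p * r2 j) (nu * rho) oN.
have y2b := @alternating_bound N (fun j => q * x1 j - c * x2 j)
  (fun j => q * r1 j - c * r2 j) (nu * rho) oN.
have {}y1b j : `|c * x1 j + p * x2 j| <= N%:R / 2 * (nu * rho).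
  apply: y1b => {}j; first by rewrite p1 p2.
    rewrite -e1 -e2; apply/eqP; rewrite -subr_eq0; apply/eqP.
    transitivity (- (c ^+ 2 + p * q) * x1 j.+1); first by ring.
    by rewrite nil oppr0 mul0r.
  by have [] := nuX _ _ _ (r1b j) (r2b j).
have {}y2b j : `|q * x1 j - c * x2 j| <= N%:R / 2 * (nu * rho).
  apply: y2b => {}j; first by rewrite p1 p2.
    rewrite -e1 -e2; apply/eqP; rewrite -subr_eq0; apply/eqP.
    transitivity (- (c ^+ 2 + p * q) * x2 j.+1); first by ring.
    by rewrite nil oppr0 mul0r.
  by have [] := nuX _ _ _ (r1b j) (r2b j).
move=> j; split.
- apply: (@alternating_bound N x1 (fun j => r1 j - (c * x1 j.+1 + p * x2 j.+1))) => // {}j.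
    by rewrite -e1 addrK.
  by apply: le_trans (ler_normB _ _) _; rewrite lerD.
- apply: (@alternating_bound N x2 (fun j => r2 j - (q * x1 j.+1 - c * x2 j.+1))) => // {}j.
    by rewrite -e2 addrK.
  by apply: le_trans (ler_normB _ _) _; rewrite lerD.
Qed.

End AlternatingRecurrence.

Section Recurrence.
Variable R : realType.
Variables (k : nat) (h alpha1 beta1 beta2 : R).
Hypotheses (h0 : 0 < h) (k0 : (0 < k)%N).
Hypothesis D0 : alpha1 ^+ 2 + beta1 * beta2 != 1 / 4.
Local Notation G := (Gamma k h alpha1 beta1 beta2).
Local Notation L := (Lambda k h alpha1 beta1 beta2).
Local Notation c2 := (c2 k h alpha1).
Local Notation b1 := (b1 k h alpha1 beta1 beta2).
Local Notation b2 := (b2 k h alpha1 beta1 beta2).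

Lemma natk_neq0 : k%:R != 0 :> R. Proof. by rewrite pnatr_eq0 -lt0n. Qed.
Lemma h_neq0 : h != 0. Proof. by rewrite gt_eqF. Qed.

Lemma Lambda_neq0 : L != 0.
Proof.
by rewrite /Lambda mulf_neq0 ?oppr_eq0 ?subr_eq0// mulf_neq0 ?invr_neq0 ?h_neq0//
  mulf_neq0 ?natk_neq0 ?pnatr_eq0.
Qed.

(** As [Q2] has trace zero, the left-hand side is the scalar by which its square multiplies the
    identity. *)
Lemma Q2_sqr : c2 ^+ 2 + (b1 + b2) * (b1 - b2) = G ^+ 2 - L ^+ 2.
Proof.
rewrite /Defs.c2 /Defs.b1 /Defs.b2 /Gamma /Lambda.
by field; rewrite h_neq0.
Qed.

(** Here [x] and [y] are the shifted last two coefficients of the left and the right cell, and the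
    two equations are the interface conditions after the data of [u] have cancelled. Since [{w} -
    alpha1 [w]] weighs the right trace by [1/2 - alpha1] and the left one by [1/2 + alpha1], the
    system can be solved for [x]. *)
Lemma transfer_step (sg x1 x2 y1 y2 gm gp : R) : sg ^+ 2 = 1 -> - sg * G = L ->
  (1 / 2 - alpha1) * (gp + sg * (y1 - y2)) + (1 / 2 + alpha1) * (x1 + x2) +
    beta2 * (sg * (- (k%:R * (k%:R - 1)) * y1 + k%:R * (k%:R + 1) * y2) / h
      - ((k%:R * (k%:R - 1) * x1 + k%:R * (k%:R + 1) * x2) / h + gm)) = 0 ->
  (1 / 2 + alpha1) * (sg * (- (k%:R * (k%:R - 1)) * y1 + k%:R * (k%:R + 1) * y2) / h) +
    (1 / 2 - alpha1) * ((k%:R * (k%:R - 1) * x1 + k%:R * (k%:R + 1) * x2) / h + gm) +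
    beta1 * ((gp + sg * (y1 - y2)) - (x1 + x2)) = 0 ->
  x1 + y1 + (c2 * y1 + (b1 + b2) * y2) / G =
    - (V2 k h 0 0 * gm + V1 k h alpha1 beta1 beta2 0 0 * gp) /\
  x2 + y2 + ((b1 - b2) * y1 - c2 * y2) / G =
    - (V2 k h 1 0 * gm + V1 k h alpha1 beta1 beta2 1 0 * gp).
Proof.
move=> sg2 sgG E1 E2.
have kn0 := natk_neq0; have hn0 := h_neq0; have Ln0 := Lambda_neq0.
have sg0 : sg != 0 by apply/eqP => sg0; move/eqP: sg2; rewrite sg0 expr0n/= eq_sym oner_eq0.
have Gn0 : G != 0 by apply: contraNneq Ln0 => G0; rewrite -sgG G0 mulr0.
have GL : - sg / L = G^-1 by rewrite -sgG; field; rewrite sg0 Gn0.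
have D0' : 1 / 4 - alpha1 ^+ 2 - beta1 * beta2 != 0.
  by rewrite -addrA -opprD subr_eq0 eq_sym.
set D := 1 / 4 - alpha1 ^+ 2 - beta1 * beta2 in D0'.
have LE : L = 2 * k%:R * D / h by rewrite /Lambda /D; field; rewrite hn0.
have V1E : V1 k h alpha1 beta1 beta2 0 0 = L^-1 * (- beta1 + k%:R * (k%:R + 1) / h
    * ((1 / 2 - alpha1) ^+ 2 + beta1 * beta2)) by rewrite !mxE.
have V1E' : V1 k h alpha1 beta1 beta2 1 0 = L^-1 * (beta1 - k%:R * (k%:R - 1) / h
    * ((1 / 2 - alpha1) ^+ 2 + beta1 * beta2)) by rewrite !mxE.
have V2E : V2 k h 0 0 = - (h / (2 * k%:R)) :> R by rewrite !mxE.
have V2E' : V2 k h 1 0 = h / (2 * k%:R) :> R by rewrite !mxE.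
rewrite {}V1E {}V1E' {}V2E {}V2E'.
set lhs1 := LHS in E1; set lhs2 := LHS in E2.
(* The relation [- sg / L = G^-1] turns the coefficients of the right cell into [I + Q2 / G]. *)
have solve (z w e1 e2 X Y : R) : z + (- sg / L) * (G * w + X) + Y = e1 * lhs1 + e2 * lhs2 ->
    z + w + X / G = - Y.
  rewrite E1 E2 !mulr0 addr0 GL mulrDr mulKf// => /eqP.
  by rewrite addr_eq0 => /eqP <-; rewrite addrA [X / G]mulrC.
(* The multipliers are the rows of the inverse of the left-cell matrix, whose determinant is
   [L = 2 k D / h]. *)
split; [apply: (solve _ _ (h / (2 * k%:R * D) * (k%:R * (k%:R + 1) / h * (1 / 2 - alpha1) - beta1))
    (h / (2 * k%:R * D) * (k%:R * (k%:R + 1) / h * beta2 - (1 / 2 + alpha1))))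
  | apply: (solve _ _ (h / (2 * k%:R * D) * (- (k%:R * (k%:R - 1) / h) * (1 / 2 - alpha1) + beta1))
    (h / (2 * k%:R * D) * (- (k%:R * (k%:R - 1) / h) * beta2 + (1 / 2 + alpha1))))];
  rewrite /lhs1 /lhs2 /Gamma /Defs.c2 /Defs.b1 /Defs.b2 LE /D; field;
  rewrite hn0 kn0 /= andbT; move: D0'; rewrite /D; apply: contra_neq => H; lra.
Qed.

End Recurrence.

(** * Norms and traces on the mesh *)

Section LpBound.
Variable R : realType.
Implicit Types (a b x y B c : R) (f : R -> R).
Local Notation mu := (@lebesgue_measure R).

Lemma Lpnorm2_le a b f B : a < b -> 0 <= B -> measurable_fun `[a, b] f ->
  {ae mu, forall x, x \in `[a, b] -> `|f x| <= B} ->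
  (Lpnorm 2%:E `[a, b] f <= (B * Num.sqrt (b - a))%:E)%E.
Proof.
move=> ab B0 mf fB; rewrite /Lpnorm unlock /=.
have ba0 : 0 <= b - a by rewrite subr_ge0 ltW.
have -> : (B * Num.sqrt (b - a))%:E = (((B ^+ 2 * (b - a))%:E `^ 2^-1))%E.
  by rewrite poweR_EFin powR12_sqrt ?mulr_ge0 ?exprn_ge0// sqrtrM ?exprn_ge0// sqrtr_sqr ger0_norm.
apply: gt0_ler_poweR; rewrite ?invr_ge0//.
- by rewrite in_itv/= leey andbT; apply: integral_ge0 => x _; rewrite lee_fin powR_ge0.
- by rewrite in_itv/= leey andbT lee_fin mulr_ge0// exprn_ge0.
have -> : (fun x => (`|(f \_ `[a, b]) x| `^ 2)%:E) =
    (fun x => (`|f x| ^+ 2)%:E)%E \_ `[a, b].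
  apply/funext => x; rewrite !patchE; case: ifPn => _.
    by rewrite powR_mulrn.
  by rewrite normr0 powR_mulrn// expr0n.
rewrite -integral_mkcond.
have mab : fine (mu `[a, b]) = b - a by rewrite lebesgue_measure_itv/= lte_fin ab.
have -> : ((B ^+ 2 * (b - a))%:E = \int[mu]_(x in `[a, b]) (B ^+ 2)%:E)%E.
  rewrite integral_cst// -mab EFinM fineK// lebesgue_measure_itv/= lte_fin ab.
  by rewrite -EFinB.
apply: ae_ge0_le_integral => //.
- apply/measurable_EFinP; apply: measurable_funX; exact: measurableT_comp.
- by move=> x _; rewrite lee_fin exprn_ge0.
- move: fB; apply: (@filterS _ _ (ae_filter_ringOfSetsType mu)) => x fB xab.
  by rewrite lee_fin lerXn2r ?nnegrE// fB.
Qed.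

Lemma lebesgue_measureT_gt0 : (0 < mu setT)%E.
Proof.
apply: (@lt_le_trans _ _ (mu `[0, 1])).
  by rewrite lebesgue_measure_itv/= lte_fin ltr01 -EFinB lte_fin subr0.
by apply: le_measure; rewrite ?inE.
Qed.

Lemma Lpnormoo_leP (I : set R) f B : 0 <= B ->
  (Lpnorm +oo I f <= B%:E)%E <-> {ae mu, forall x, x \in I -> `|f x| <= B}.
Proof.
move=> B0; rewrite /Lpnorm unlock lebesgue_measureT_gt0.
split.
  move=> /ess_supP; apply: (@filterS _ _ (ae_filter_ringOfSetsType mu)) => x /=.
  by rewrite patchE => /[swap] ->; rewrite lee_fin.
move=> fB; apply/ess_supP; move: fB.
apply: (@filterS _ _ (ae_filter_ringOfSetsType mu)) => x /= fB.
by rewrite patchE; case: ifPn => [/fB|_]; rewrite lee_fin ?normr0.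
Qed.

Lemma Lpnorm_le a b f B p : a < b -> 0 <= B -> measurable_fun `[a, b] f ->
  {ae mu, forall x, x \in `[a, b] -> `|f x| <= B} -> p = 2%:E \/ p = +oo%E ->
  (Lpnorm p `[a, b] f <= (B * (1 + Num.sqrt (b - a)))%:E)%E.
Proof.
move=> ab B0 mf fB [->|->].
  apply: le_trans (Lpnorm2_le ab B0 mf fB) _.
  by rewrite lee_fin ler_wpM2l// lerDr.
apply: (@le_trans _ _ B%:E); last by rewrite lee_fin ler_peMr// lerDl sqrtr_ge0.
apply/Lpnormoo_leP => //; move: fB.
by apply: (@filterS _ _ (ae_filter_ringOfSetsType mu)) => x /= fB; rewrite inE/=; exact: fB.
Qed.

End LpBound.

Section MeshFunctions.
Variable R : realType.
Variables (a b : R) (N : nat).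
Hypotheses (ab : a < b) (N0 : (0 < N)%N).
Implicit Types (x y B : R) (f : R -> R) (j n : nat).
Local Notation mu := (@lebesgue_measure R).
Local Notation h := (mesh_size a b N).
Local Notation node := (node a b N).
Local Notation cell := (cell a b N).

Lemma mesh_size_gt0 : 0 < h.
Proof. by rewrite /mesh_size divr_gt0 ?subr_gt0// ltr0n. Qed.

Lemma node0 : node 0 = a.
Proof. by rewrite /Defs.node mul0r addr0. Qed.

Lemma nodeN : node N = b.
Proof.
by rewrite /Defs.node /mesh_size mulrC divfK ?pnatr_eq0 -?lt0n// addrC subrK.
Qed.

Lemma nodeS j : node j.+1 = node j + h.
Proof. by rewrite /Defs.node -natr1 mulrDl mul1r addrA. Qed.

Lemma node_le i j : (i <= j)%N -> node i <= node j.
Proof.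
by move=> ij; rewrite lerD2l ler_wpM2r ?ler_nat// ltW// mesh_size_gt0.
Qed.

(** Nothing is known about [f] at the nodes, so the closed interval is built up by one open cell and
    one point at a time. *)
Lemma mesh_measurable f :
  (forall j, (j < N)%N -> exists2 g : R -> R, continuous g &
    forall x, cell j x -> f x = g x) ->
  measurable_fun `[a, b] f.
Proof.
move=> fg; rewrite -nodeN -{1}node0.
suff H n : (n <= N)%N -> measurable_fun `[node 0, node n] f by exact: H.
elim: n => [_|n IH nN].
  by rewrite set_itv1; exact: measurable_fun_set1.
have nle := node_le (leq0n n); have nlt : node n < node n.+1.
  by rewrite nodeS ltrDl mesh_size_gt0.
have -> : `[node 0, node n.+1]%classic =
    `[node 0, node n]%classic `|` (cell n `|` [set node n.+1]).
  apply/seteqP; split => x /=; rewrite !in_itv/=.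
    move=> /andP[x0 xn]; have [xle|xgt] := leP x (node n); first by left; rewrite x0.
    right; move: xn; rewrite le_eqVlt => /predU1P[->|xlt]; first by right.
    by left; rewrite /Defs.cell /= in_itv/= xgt.
  move=> [/andP[-> /le_trans -> //]|[|->]]; first exact: ltW.
    by rewrite /Defs.cell /= in_itv/= => /andP[x1 /ltW ->]; rewrite (le_trans nle (ltW x1)).
  by rewrite lexx (le_trans nle (ltW nlt)).
have mc : measurable (cell n) by exact: measurable_itv.
apply/measurable_funU; [exact: measurable_itv|exact: measurableU|].
split; first exact: IH (ltnW nN).
apply/measurable_funU => //; split; last exact: measurable_fun_set1.
have [g cg Hg] := fg n nN.
apply: (eq_measurable_fun g) => [x /set_mem cx|]; first by rewrite Hg.
by apply: measurable_funTS; exact: continuous_measurable_fun.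
Qed.

Lemma mesh_ae f B : (forall j x, (j < N)%N -> cell j x -> `|f x| <= B) ->
  {ae mu, forall x, x \in `[a, b] -> `|f x| <= B}.
Proof.
move=> fB; have ne c : {ae mu, forall x, x != c}.
  exists [set c]; split; [exact: measurable_set1|exact: lebesgue_measure_set1|].
  by move=> x /=; apply: contra_notP => /eqP.
suff H n : (n <= N)%N -> {ae mu, forall x, x \in `[node 0, node n] -> `|f x| <= B}.
  move: (H N (leqnn N)); apply: (@filterS _ _ (ae_filter_ringOfSetsType mu)) => x.
  by rewrite node0 nodeN.
elim: n => [_|n IH nN].
  move: (ne (node 0)); apply: (@filterS _ _ (ae_filter_ringOfSetsType mu)) => x /eqP x0.
  by rewrite in_itv/= -eq_le => /eqP/esym.
move: (IH (ltnW nN)) (ne (node n)) (ne (node n.+1)).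
apply: (@filterS3 _ _ (ae_filter_ringOfSetsType mu)) => x H xn xn1.
rewrite in_itv/= => /andP[x0 xle].
have [xle'|xgt] := leP x (node n); first by apply: H; rewrite in_itv/= x0.
apply: (fB n) => //; rewrite /Defs.cell /= in_itv/= xgt/=.
by rewrite lt_neqAle xn1.
Qed.

End MeshFunctions.

Section Traces.
Variable R : realType.
Implicit Types (x y xL xR : R) (f : R -> R) (q : {poly R}).

Lemma trace_left xL xR f q : xL < xR -> (forall x, xL < x < xR -> f x = q.[x]) ->
  lim (f y @[y --> xR^'-]) = q.[xR].
Proof.
move=> LR fq; apply: cvg_lim => //.
apply: (@cvg_trans _ (q.[y] @[y --> xR^'-])); last first.
  by apply: cvg_at_left_filter; exact: continuous_horner.
apply: near_eq_cvg; near=> y; rewrite fq//; apply/andP; split; near: y.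
  exact: nbhs_left_gt.
exact: nbhs_left_lt.
Unshelve. all: by end_near. Qed.

Lemma trace_right xL xR f q : xL < xR -> (forall x, xL < x < xR -> f x = q.[x]) ->
  lim (f y @[y --> xL^'+]) = q.[xL].
Proof.
move=> LR fq; apply: cvg_lim => //.
apply: (@cvg_trans _ (q.[y] @[y --> xL^'+])); last first.
  by apply: cvg_at_right_filter; exact: continuous_horner.
apply: near_eq_cvg; near=> y; rewrite fq//; apply/andP; split; near: y.
  exact: nbhs_right_gt.
exact: nbhs_right_lt.
Unshelve. all: by end_near. Qed.

Lemma derive1_eq_poly xL xR f q : (forall x, xL < x < xR -> f x = q.[x]) ->
  forall x, xL < x < xR -> derive1 f x = q^`().[x].
Proof.
move=> fq x /andP[xL' xR']; apply: derive1_is_derive.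
suff qf : \forall y \near x, q.[y] = f y by exact: near_eq_is_derive qf (is_derive_poly q x).
near=> y; rewrite fq//; apply/andP; split; near: y; first exact: lt_nbhsr.
exact: lt_nbhsl.
Unshelve. all: by end_near. Qed.

End Traces.

(** * Error decomposition on a cell *)

Section ReferenceCell.
Variable R : realType.
Implicit Types (x t h dL dR K T : R) (e : {poly R}) (n i : nat).

(** [S] bounds the low-order part of the error and its derivative relative to the scale [T], [tau]
    bounds the shift [t2], and [S + tau] the shift [t1]; [c] is [k^2] for [k = n.+1]. *)
Definition ref_const n K : R :=
  let S := n%:R * (K * K * K) in let c := n.+1%:R ^+ 2 in
  let tau := S + 1 + c * S in S + 1 + 3 * c * (S + tau) + K * (2 * S + 2 * tau).

Lemma ref_const_ge0 n K : 1 <= K -> 0 <= ref_const n K.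
Proof.
move=> K1; have K0 : 0 <= K by rewrite (le_trans ler01).
by rewrite /ref_const/= !(addr_ge0, mulr_ge0, exprn_ge0).
Qed.

Lemma normD_le (x y X Y : R) : `|x| <= X -> `|y| <= Y -> `|x + y| <= X + Y.
Proof. by move=> xX yY; apply: le_trans (ler_normD _ _) (lerD xX yY). Qed.

Lemma normM_le (x y X Y : R) : `|x| <= X -> `|y| <= Y -> `|x * y| <= X * Y.
Proof. by move=> xX yY; rewrite normrM; apply: ler_pM. Qed.

(* The shift [t] makes the value at the right end and the derivative at the
   left end exact; the defects [gp], [gm] then only enter through the
   columns of [V1] and [V2]. *)
Lemma ref_decomposition n K T h dL dR e : 1 <= K -> 0 < h -> 0 <= T ->
  (forall i, (i <= n.+1)%N -> [/\ forall x, 0 <= x <= 1 -> `|(@legendre R i).[x]| <= K &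
    forall x, 0 <= x <= 1 -> `|(@legendre R i)^`().[x]| <= K]) ->
  (size e <= n.+2)%N -> (forall i, (i < n)%N -> `|legendre_coef e i| <= T * K * K) ->
  h * `|dL| <= T -> h * `|dR| <= T ->
  let k : R := n.+1%:R in let sg : R := (-1) ^+ n in
  exists a1 a2 gm gp : R, [/\ e.[1] = a1 + a2 /\
      e^`().[1] / h + dR = (k * (k - 1) * a1 + k * (k + 1) * a2) / h + gm,
    e.[0] = gp + sg * (a1 - a2) /\
      e^`().[0] / h + dL = sg * (- (k * (k - 1)) * a1 + k * (k + 1) * a2) / h,
    `|gp| <= ref_const n K * T /\ h * `|gm| <= ref_const n K * T &
    forall x, 0 <= x <= 1 -> `|e.[x]| <= ref_const n K * T + K * (`|a1| + `|a2|)].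
Proof.
move=> K1 h0 T0 HK se ce hL hR k sg.
have K0 : 0 <= K by rewrite (le_trans ler01).
have hn0 : h != 0 by rewrite gt_eqF.
have k1 : 1 <= k by rewrite /k ler1n.
have kn0 : k != 0 by rewrite pnatr_eq0.
have nk : n%:R = k - 1 :> R by rewrite /k -natr1 addrK.
have sg1 : `|sg| = 1 by rewrite normrX normrN1 expr1n.
have sg2 : sg * sg = 1 by rewrite -expr2 /sg sqrr_sign.
pose s : {poly R} := \sum_(i < n) legendre_coef e i *: legendre i.
pose c := legendre_coef e n; pose d := legendre_coef e n.+1.
have es : e = s + c *: legendre n + d *: legendre n.+1.
  by rewrite {1}(legendre_expansion se) !big_ord_recr.
have eE x : e.[x] = s.[x] + c * (legendre n).[x] + d * (legendre n.+1).[x].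
  by rewrite {1}es 2!hornerD (hornerZ c) (hornerZ d).
have e'E x : e^`().[x] =
    s^`().[x] + c * (legendre n)^`().[x] + d * (legendre n.+1)^`().[x].
  by rewrite {1}es 2!derivD (derivZ c) (derivZ d) 2!hornerD (hornerZ c) (hornerZ d).
pose S := n%:R * (K * K * K).
have S0 : 0 <= S by rewrite !mulr_ge0.
have sb x : 0 <= x <= 1 -> `|s.[x]| <= S * T.
  move=> x01; rewrite horner_sum; apply: le_trans (ler_norm_sum _ _ _) _.
  have -> : S * T = \sum_(i < n) (T * K * K * K).
    by rewrite sumr_const card_ord -[RHS]mulr_natr /S; ring.
  apply: ler_sum => i _; rewrite hornerZ; apply: normM_le; first exact: ce.
  by have [HL _] := HK i (leq_trans (ltnW (ltn_ord i)) (leqnSn n)); exact: HL.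
have s'b x : 0 <= x <= 1 -> `|s^`().[x]| <= S * T.
  move=> x01; rewrite /s (raddf_sum (@deriv R))/= horner_sum.
  apply: le_trans (ler_norm_sum _ _ _) _.
  have -> : S * T = \sum_(i < n) (T * K * K * K).
    by rewrite sumr_const card_ord -[RHS]mulr_natr /S; ring.
  apply: ler_sum => i _; rewrite derivZ hornerZ; apply: normM_le; first exact: ce.
  by have [_ HL] := HK i (leq_trans (ltnW (ltn_ord i)) (leqnSn n)); exact: HL.
have i0 : 0 <= (0 : R) <= 1 by rewrite lexx ler01.
have i1 : 0 <= (1 : R) <= 1 by rewrite lexx ler01.
have s0b := sb 0 i0; have s1b := sb 1 i1; have s'0b := s'b 0 i0; have s'1b := s'b 1 i1.
(* The shifts solve [t1 + t2 = - s(1)] together with the vanishing of the defect in the left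
   derivative; the denominator is [k (k - 1) + k (k + 1) = 2 k^2]. *)
pose t2 := - (sg * (s^`().[0] + h * dL) + k * (k - 1) * s.[1]) / (2 * k ^+ 2).
pose t1 := - s.[1] - t2.
pose tau := S + 1 + k ^+ 2 * S.
have tau0 : 0 <= tau by rewrite !addr_ge0 ?mulr_ge0 ?exprn_ge0.
have hdL : `|h * dL| <= T by rewrite normrM gtr0_norm.
have hdR : `|h * dR| <= T by rewrite normrM gtr0_norm.
have km : `|k * (k - 1)| <= k ^+ 2 by rewrite ger0_norm; nra.
have kp : `|k * (k + 1)| <= 2 * k ^+ 2 by rewrite ger0_norm; nra.
have t2b : `|t2| <= tau * T.
  have -> : tau * T = 1 * (S * T + T) + k ^+ 2 * (S * T) by rewrite /tau; ring.
  rewrite normrM normrN normfV -[leRHS]mulr1.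
  apply: ler_pM => //.
    apply: normD_le; apply: normM_le => //; first by rewrite sg1.
    exact: normD_le.
  rewrite ger0_norm ?mulr_ge0 ?exprn_ge0 ?(le_trans ler01 k1)//.
  by rewrite invf_le1; nra.
have t1b : `|t1| <= S * T + tau * T.
  by rewrite /t1; apply: normD_le; rewrite normrN.
exists (c - t1), (d - t2).
exists ((s^`().[1] + k * (k - 1) * t1 + k * (k + 1) * t2) / h + dR), (s.[0] + sg * (t1 - t2)).
have ST0 : 0 <= S * T by exact: mulr_ge0.
have tT0 : 0 <= tau * T by exact: mulr_ge0.
have c0 : 0 <= k ^+ 2 by exact: sqr_ge0.
have refE : ref_const n K * T =
   S * T + T + 3 * (k ^+ 2 * (S * T)) + 3 * (k ^+ 2 * (tau * T)) +
     2 * (K * (S * T)) + 2 * (K * (tau * T)).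
  by rewrite /ref_const -/S -/k -/tau /=; ring.
have c1 : 1 <= k ^+ 2 by rewrite exprn_ege1.
have P1 : 0 <= k ^+ 2 * (S * T) by exact: mulr_ge0.
have P2 : 0 <= k ^+ 2 * (tau * T) by exact: mulr_ge0.
have P3 : S * T <= K * (S * T) by rewrite ler_peMl.
have P4 : tau * T <= K * (tau * T) by rewrite ler_peMl.
split.
- split; first by rewrite eE !legendre_1 /t1; ring.
  rewrite e'E !deriv_legendre_1 nk.
  by rewrite -/k; field.
- split.
    by rewrite eE !legendre_0 exprS -/sg; ring.
  rewrite e'E !deriv_legendre_0 nk exprS -/sg -/k.
  have -> : s^`().[0] = - h * dL - sg * (k * (k - 1) * s.[1] + 2 * k ^+ 2 * t2).
    have -> : 2 * k ^+ 2 * t2 = - (sg * (s^`().[0] + h * dL) + k * (k - 1) * s.[1]).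
      by rewrite /t2; field.
    transitivity (- h * dL + sg * sg * (s^`().[0] + h * dL)); last by ring.
    by rewrite sg2; ring.
  by rewrite /t1; field.
- rewrite refE; split.
    have : `|s.[0] + sg * (t1 - t2)| <= S * T + 1 * ((S * T + tau * T) + tau * T).
      apply: normD_le => //; apply: normM_le; first by rewrite sg1.
      by apply: normD_le; rewrite ?normrN.
    lra.
  rewrite -[h in h * `|_|]gtr0_norm// -normrM mulrDr mulrCA divff// mulr1.
  have : `|s^`().[1] + k * (k - 1) * t1 + k * (k + 1) * t2 + h * dR| <=
      S * T + k ^+ 2 * (S * T + tau * T) + 2 * k ^+ 2 * (tau * T) + T.
    apply: normD_le => //; apply: normD_le; last exact: normM_le.
    by apply: normD_le => //; exact: normM_le.
  lra.
- move=> x x01; rewrite eE refE.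
  have [Hn _] := HK n (leqnSn n); have [Hn1 _] := HK n.+1 (leqnn _).
  have : `|s.[x] + c * (legendre n).[x] + d * (legendre n.+1).[x]| <=
      S * T + (`|c - t1| + (S * T + tau * T)) * K + (`|d - t2| + tau * T) * K.
    apply: normD_le; [apply: normD_le; first exact: sb|]; apply: normM_le.
    + by rewrite -{1}(subrK t1 c); apply: normD_le.
    + exact: Hn.
    + by rewrite -{1}(subrK t2 d); apply: normD_le.
    + exact: Hn1.
  lra.
Qed.

End ReferenceCell.

Section CellData.
Variable R : realType.
Local Notation mu := (@lebesgue_measure R).

(** Stating all four traces relative to [u] lets the data cancel later. The scale is [T = M h^(k+1)]
    with [k = n.+1], and a derivative defect is measured after multiplication by [h]. *)
Lemma cell_error_decomposition n (xL h M K : R) (u w g : R -> R) (q : {poly R}) :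
  0 < h -> 0 <= M -> 1 <= K ->
  (forall i, (i <= n.+1)%N -> [/\ forall x, 0 <= x <= 1 -> `|(@legendre R i).[x]| <= K,
    forall x, 0 <= x <= 1 -> `|(@legendre R i)^`().[x]| <= K &
    (integral01 (@legendre R i * legendre i))^-1 <= K]) ->
  continuous u -> is_weak_derivative n.+2 u g ->
  {ae mu, forall z, z \in `[xL, xL + h] -> `|g z| <= M} ->
  derivable u xL 1 -> derivable u (xL + h) 1 ->
  (size q <= n.+2)%N -> (forall x, xL < x < xL + h -> w x = q.[x]) ->
  (forall v : {poly R}, (size v <= n)%N ->
    \int[mu]_(x in `]xL, xL + h[) (w x * v.[x]) =
    \int[mu]_(x in `]xL, xL + h[) (u x * v.[x])) ->
  let k : R := n.+1%:R in let sg : R := (-1) ^+ n in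
  let E : R := ref_const n K * (M * h ^+ n.+2) in
  exists a1 a2 gm gp : R, [/\
    lim (w y @[y --> (xL + h)^'-]) = u (xL + h) + (a1 + a2) /\
    lim (derive1 w y @[y --> (xL + h)^'-]) = derive1 u (xL + h) +
      ((k * (k - 1) * a1 + k * (k + 1) * a2) / h + gm),
    lim (w y @[y --> xL^'+]) = u xL + (gp + sg * (a1 - a2)) /\
    lim (derive1 w y @[y --> xL^'+]) = derive1 u xL +
      sg * (- (k * (k - 1)) * a1 + k * (k + 1) * a2) / h,
    `|gp| <= E /\ h * `|gm| <= E &
    forall x, xL < x < xL + h ->
      `|w x - u x| <= E + M * h ^+ n.+2 + K * (`|a1| + `|a2|)].
Proof.
move=> h0 M0 K1 HK cu wg gM dL dR sq wq mom k sg E.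
have hn0 : h != 0 by rewrite gt_eqF.
have LR : xL < xL + h by rewrite ltrDl.
have [p [sp [pL pR] up dpL dpR]] := cell_interpolant (ltn0Sn n) h0 cu wg M0 gM dL dR.
have T0 : 0 <= M * h ^+ n.+2 by rewrite mulr_ge0// exprn_ge0// ltW.
pose e := to_ref xL h (q - p).
have ce i : (i < n)%N -> `|legendre_coef e i| <= M * h ^+ n.+2 * K * K.
  apply: (moment_bound h0 T0 cu _ up) => [v sv|{}i ilt].
    rewrite -mom//; apply: eq_Rintegral => x; rewrite inE/= in_itv/= => xc.
    by rewrite wq.
  by have [] := HK i (leq_trans (ltnW ilt) (leqnSn n)).
have se : (size e <= n.+2)%N.
  rewrite (leq_trans (size_to_ref _ _ _))// (leq_trans (size_polyD _ _))//.
  by rewrite size_polyN geq_max sq.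
have HK' i : (i <= n.+1)%N -> [/\ forall x, 0 <= x <= 1 -> `|(@legendre R i).[x]| <= K &
    forall x, 0 <= x <= 1 -> `|(@legendre R i)^`().[x]| <= K].
  by move=> /HK[].
have hd x : `|derive1 u x - p^`().[x]| <= M * h ^+ n.+1 ->
    h * `|p^`().[x] - derive1 u x| <= M * h ^+ n.+2.
  by rewrite distrC => H; rewrite exprS mulrCA ler_wpM2l// ltW.
have [a1 [a2 [gm [gp [[e1 e'1] [e0 e'0] gb eb]]]]] :=
  ref_decomposition K1 h0 T0 HK' se ce (hd _ dpL) (hd _ dpR).
have d0 : e^`().[0] / h = q^`().[xL] - p^`().[xL].
  rewrite /e deriv_to_ref mulr0 addr0 derivB hornerD hornerN.
  by rewrite mulrAC divff// mul1r.
have d1 : e^`().[1] / h = q^`().[xL + h] - p^`().[xL + h].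
  rewrite /e deriv_to_ref mulr1 derivB hornerD hornerN.
  by rewrite mulrAC divff// mul1r.
exists a1, a2, gm, gp; split => //.
- rewrite (trace_left LR wq) (trace_left LR (derive1_eq_poly wq)); split.
    by rewrite -e1 /e horner_to_ref mulr1 hornerD hornerN pR; ring.
  by rewrite -e'1 d1; ring.
- rewrite (trace_right LR wq) (trace_right LR (derive1_eq_poly wq)); split.
    by rewrite -e0 /e horner_to_ref mulr0 addr0 hornerD hornerN pL; ring.
  by rewrite -e'0 d0; ring.
- move=> x xc; have /andP[x1 x2] := xc; rewrite wq//.
  have -> : q.[x] - u x = e.[(x - xL) / h] - (u x - p.[x]).
    by rewrite /e -horner_to_ref_inv// hornerD hornerN; ring.
  rewrite addrAC; apply: normD_le.
    apply: eb; rewrite ler_pdivrMr// mul1r divr_ge0 ?subr_ge0 ?(ltW x1) ?(ltW h0)//=.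
    by rewrite lerBlDl ltW.
  by rewrite normrN; apply: up; rewrite in_itv/= !ltW.
Qed.

End CellData.

(** * Periodic closure and stability of the recurrence *)

Section PeriodicRecurrence.
Variable R : realType.
Local Notation mu := (@lebesgue_measure R).

Lemma derive1_periodic (u : R -> R) l : (forall x, u (x + l) = u x) ->
  forall x, derive1 u (x + l) = derive1 u x.
Proof.
move=> ul x; have /(congr1 (fun f => f x)) := derive1_shift u (- l).
by rewrite opprK => <-; congr (derive1 _ x); apply/funext => y; rewrite ?opprK ul.
Qed.

Lemma Lfun_oo_ae_le (g : R -> R) : g \in Lfun mu +oo%E ->
  exists2 M : R, 0 <= M & {ae mu, forall z, `|g z| <= M}.
Proof.
move=> /sub_Lfun_finLfun; rewrite inE /= /finite_norm => gfin.
have gE : Lnorm mu +oo%E (EFin \o g) = Lpnorm +oo%E setT g.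
  by rewrite /Lpnorm; congr Lnorm; apply/funext => x /=; rewrite patchE in_setT.
rewrite gE in gfin.
have g0 : (0 <= Lpnorm +oo%E setT g)%E by exact: Lnorm_ge0.
exists (fine (Lpnorm +oo%E setT g)); first exact: fine_ge0.
have : (Lpnorm +oo%E setT g <= (fine (Lpnorm +oo%E setT g))%:E)%E.
  by rewrite fineK// ge0_fin_numE.
move=> /(Lpnormoo_leP _ _ (fine_ge0 g0)).
apply: (@filterS _ _ (ae_filter_ringOfSetsType mu)) => x; apply; exact: in_setT.
Qed.

End PeriodicRecurrence.

Section Stability.
Variable R : realType.

(** [W * E] bounds the right-hand side of the recurrence and [nu] the nilpotent part [Q2 / G]; the
    nested factors [N / 2] belong to the two alternating recurrences. *)
Lemma stability_bound n (a b alpha1 beta1 beta2 sg E : R) N (a1 a2 gm gp : nat -> R) :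
  let k := n.+1 in let h := mesh_size a b N in
  let G := Gamma k h alpha1 beta1 beta2 in
  let nu := induced_norm (Q2 k h alpha1 beta1 beta2) / `|G| in
  let W := `|V1 k h alpha1 beta1 beta2| + h^-1 * `|V2 k h| in
  a < b -> odd N -> alpha1 ^+ 2 + beta1 * beta2 != 1 / 4 ->
  sg ^+ 2 = 1 -> - sg * G = Lambda k h alpha1 beta1 beta2 ->
  (forall j, (j < N)%N -> `|gp j| <= E) -> (forall j, (j < N)%N -> h * `|gm j| <= E) ->
  (forall j, (j < N)%N -> let y1 := a1 (j.+1 %% N)%N in let y2 := a2 (j.+1 %% N)%N in
    let P := gp (j.+1 %% N)%N + sg * (y1 - y2) in
    let P' := sg * (- (k%:R * (k%:R - 1)) * y1 + k%:R * (k%:R + 1) * y2) / h in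
    let M := a1 j + a2 j in
    let M' := (k%:R * (k%:R - 1) * a1 j + k%:R * (k%:R + 1) * a2 j) / h + gm j in
    (1 / 2 - alpha1) * P + (1 / 2 + alpha1) * M + beta2 * (P' - M') = 0 /\
    (1 / 2 + alpha1) * P' + (1 / 2 - alpha1) * M' + beta1 * (P - M) = 0) ->
  forall j, (j < N)%N ->
    let B := N%:R / 2 * (W * E + N%:R / 2 * (nu * (W * E))) in
    `|a1 j| <= B /\ `|a2 j| <= B.
Proof.
move=> k h G nu W ab oN D0 sg2 sgG gpE gmE rec.
have N0 : (0 < N)%N by case: (N) oN.
have h0 : 0 < h by exact: mesh_size_gt0.
have L0 := Lambda_neq0 h0 (ltn0Sn n) D0.
have G0 : G != 0 by apply: contraNneq L0 => G0; rewrite -sgG -/G G0 mulr0.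
(* Reduction modulo [N] extends the cell data to periodic sequences on all naturals. *)
pose m j := (j %% N)%N.
have mN j : (m j < N)%N by rewrite ltn_mod.
have mS j : ((m j).+1 %% N)%N = m j.+1 by rewrite /m -addn1 modnDml addn1.
have mP j : m (j + N)%N = m j by rewrite /m modnDr.
pose v1 i := V1 k h alpha1 beta1 beta2 i 0; pose v2 i := V2 k h i 0.
pose r i j := - (v2 i * gm (m j) + v1 i * gp (m j.+1)).
have rb i j : `|r i j| <= W * E.
  rewrite /r normrN; apply: le_trans (ler_normD _ _) _; rewrite /W mulrDl addrC.
  apply: lerD; first by apply: normM_le; [exact: mx_entry_le|exact: gpE].
  (* Only [h * gm] is bounded by [E], hence the factor [h^-1] in front of [V2]. *)
  rewrite [h^-1 * _]mulrC -mulrA; apply: normM_le; first exact: mx_entry_le.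
  by rewrite mulrC ler_pdivlMr// mulrC gmE.
set c2' := c2 k h alpha1; set b1' := b1 k h alpha1 beta1 beta2.
set b2' := b2 k h alpha1 beta1 beta2.
have step j : a1 (m j) + a1 (m j.+1) +
      (c2' / G * a1 (m j.+1) + (b1' + b2') / G * a2 (m j.+1)) = r 0 j /\
    a2 (m j) + a2 (m j.+1) +
      ((b1' - b2') / G * a1 (m j.+1) - c2' / G * a2 (m j.+1)) = r 1 j.
  have [E1 E2] := rec (m j) (mN j); rewrite mS in E1 E2.
  rewrite /r /v1 /v2; have [<- <-] := transfer_step h0 (ltn0Sn n) D0 sg2 sgG E1 E2.
  by split; rewrite -/G -/c2' -/b1' -/b2'; congr (_ + _); ring.
(* By [Q2_sqr] the numerator is [G^2 - L^2], which vanishes since [L = - sg * G] and [sg^2 = 1]. *)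
have nil : (c2' / G) ^+ 2 + (b1' + b2') / G * ((b1' - b2') / G) = 0.
  transitivity ((c2' ^+ 2 + (b1' + b2') * (b1' - b2')) / G ^+ 2); first by field.
  rewrite /c2' /b1' /b2' (Q2_sqr k alpha1 beta1 beta2 h0) -/G -sgG -/G.
  by rewrite exprMn sqrrN sg2 mul1r subrr mul0r.
have nuX (x y X : R) : `|x| <= X -> `|y| <= X ->
    `|c2' / G * x + (b1' + b2') / G * y| <= nu * X /\
    `|(b1' - b2') / G * x - c2' / G * y| <= nu * X.
  move=> xX yX.
  have [H1 H2] := mx22_norm_ge c2' (b1' + b2') (b1' - b2') (- c2') xX yX.
  have Gp : 0 < `|G| by rewrite normr_gt0.
  have -> : c2' / G * x + (b1' + b2') / G * y = (c2' * x + (b1' + b2') * y) / G by ring.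
  have -> : (b1' - b2') / G * x - c2' / G * y = ((b1' - b2') * x + - c2' * y) / G by ring.
  by rewrite !normrM normfV /nu [_ / _ * X]mulrAC !ler_pM2r ?invr_gt0.
move=> j jN B.
have := nilpotent_recurrence_bound (x1 := fun j => a1 (m j)) (x2 := fun j => a2 (m j))
  oN (fun j => congr1 a1 (mP j)) (fun j => congr1 a2 (mP j)) nil nuX
  (fun j => (step j).1) (fun j => (step j).2) (rb 0) (rb 1) j.
by rewrite /m modn_small.
Qed.

End Stability.

(** * The error bound on the whole interval *)

Theorem lemma3p5 (R : realType) (k : nat) (a b : R) :
  (1 <= k)%N -> a < b ->
  exists2 C : R, 0 < C &
    forall (N : nat) (alpha1 beta1 beta2 : R),
    let h := mesh_size a b N in
    let G := Gamma k h alpha1 beta1 beta2 in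
    let L := Lambda k h alpha1 beta1 beta2 in
    let K := 1 + h^-1
      * (1 + h^-1 * induced_norm (Q2 k h alpha1 beta1 beta2) / `|G|)
      * (`|V1 k h alpha1 beta1 beta2| + h^-1 * `|V2 k h|) in
    alpha1 ^+ 2 + beta1 * beta2 != 1 / 4 ->
    `|G| = `|L| ->
    odd N ->
    G = (if odd k then - L else L) ->
    forall (u w : R -> R) (p : \bar R),
    p = 2%:E \/ p = +oo%E ->
    (forall x, u (x + (b - a)) = u x) ->
    continuous u ->
    sobolev_oo k.+1 u ->
    is_Pstar a b N k alpha1 beta1 beta2 u w ->
    (Lpnorm p `[a, b] (w \- u)%R
     <= (C * h ^+ k.+1)%:E * sobolev_seminorm_oo k.+1 `[a, b] u * K%:E)%E.
Proof.
case: k => // n _ ab.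
have [K K1 HK] := legendre_bound R n.+1.
have K0 : 0 <= K by rewrite (le_trans ler01).
pose c := ref_const n K; pose l := b - a.
have c0 : 0 <= c by exact: ref_const_ge0.
have l0 : 0 < l by rewrite subr_gt0.
(* [c + 1] covers the defects and the interpolation error; the last term comes from
   [K (|a1| + |a2|)] with [N = l / h], where [1 + l / 2] dominates both levels of nesting. *)
pose C0 := c + 1 + 2 * K * (l / 2) * (1 + l / 2) * c.
have C01 : 0 < C0.
  rewrite /C0 -addrA ltr_wpDl// ltr_wpDr// !mulr_ge0//; lra.
have sl : 0 < 1 + Num.sqrt l by rewrite ltr_wpDr// sqrtr_ge0.
exists (C0 * (1 + Num.sqrt l)); first exact: mulr_gt0.
move=> N alpha1 beta1 beta2 h G L KK D0 GL oN Gk u w p p2 uper cu su [wV wP].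
have N0 : (0 < N)%N by case: (N) oN.
have h0 : 0 < h by exact: mesh_size_gt0.
have hn0 : h != 0 by rewrite gt_eqF.
pose nu := induced_norm (Q2 n.+1 h alpha1 beta1 beta2) / `|G|.
pose W := `|V1 n.+1 h alpha1 beta1 beta2| + h^-1 * `|V2 n.+1 h|.
have nu0 : 0 <= nu by rewrite divr_ge0// induced_norm_ge0.
have hV0 : 0 <= h^-1 by rewrite invr_ge0 ltW.
have W0 : 0 <= W by rewrite addr_ge0// mulr_ge0.
have KKE : KK = 1 + h^-1 * (1 + h^-1 * nu) * W by rewrite /KK /nu mulrA.
have KK0 : 0 < KK.
  by rewrite KKE ltr_wpDr// !mulr_ge0// addr_ge0// mulr_ge0.
have C1 : 0 < C0 * (1 + Num.sqrt l) * h ^+ n.+2.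
  by apply: mulr_gt0; [exact: mulr_gt0|exact: exprn_gt0].
set SN := sobolev_seminorm_oo n.+2 `[a, b] u.
have SN0 : (0 <= SN)%E by exact: Lnorm_ge0.
(* An infinite seminorm makes the right-hand side [+oo], because its other factors are positive. *)
have [SNoo|SNfin] := eqVneq SN +oo%E.
  by rewrite SNoo gt0_muley ?lte_fin// gt0_mulye ?lte_fin// leey.
have SNE : SN = (fine SN)%:E by rewrite fineK// ge0_fin_numE// ltey.
pose M := fine SN.
have M0 : 0 <= M by exact: fine_ge0.
pose g := weak_derivative n.+2 u.
(* [weak_derivative] returns a default unless a weak derivative exists; [sobolev_oo] provides
   one. *)
have wg : is_weak_derivative n.+2 u g.
  have [g' wg' _] := su n.+2 (leqnn _).
  by apply: (@xgetPex _ (fun=> 0) [set g | is_weak_derivative n.+2 u g]); exists g'.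
have gM : {ae (@lebesgue_measure R), forall z, z \in `[a, b] -> `|g z| <= M}.
  have : (Lpnorm +oo%E `[a, b] g <= M%:E)%E by rewrite -SNE.
  move=> /(Lpnormoo_leP _ _ M0).
  apply: (@filterS _ _ (ae_filter_ringOfSetsType _)) => x H xab; apply: H.
  by rewrite inE.
have du x : derivable u x 1.
  have [g2 wg2 /Lfun_oo_ae_le[M2 M20 gM2]] := su 2%N isT.
  exact: weak_derivable cu wg2 M20 gM2 x.
pose T := M * h ^+ n.+2; pose E := c * T.
have T0 : 0 <= T by rewrite mulr_ge0// exprn_ge0// ltW.
pose node := node a b N.
have nodeSE j : node j.+1 = node j + h by exact: nodeS.
pose k : R := n.+1%:R; pose sg : R := (-1) ^+ n.
(* [choice] asks for data at every natural number; indices from [N] on receive zeros. *)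
have data j : exists d : (R * R) * (R * R), (j < N)%N ->
    let: ((a1, a2), (gm, gp)) := d in [/\
    trm a b N w j = u (node j.+1) + (a1 + a2) /\
    trm a b N (derive1 w) j = derive1 u (node j.+1) +
      ((k * (k - 1) * a1 + k * (k + 1) * a2) / h + gm),
    lim (w y @[y --> (node j)^'+]) = u (node j) + (gp + sg * (a1 - a2)) /\
    lim (derive1 w y @[y --> (node j)^'+]) = derive1 u (node j) +
      sg * (- (k * (k - 1)) * a1 + k * (k + 1) * a2) / h,
    `|gp| <= E /\ h * `|gm| <= E &
    forall x, cell a b N j x -> `|w x - u x| <= E + T + K * (`|a1| + `|a2|)].
  have [jN|jN] := ltnP j N; last by exists ((0, 0), (0, 0)).
  have [q sq wq] := wV j jN; have [mom _ _] := wP j jN.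
  have gMj : {ae (@lebesgue_measure R), forall z, z \in `[node j, node j + h] -> `|g z| <= M}.
    move: gM; apply: (@filterS _ _ (ae_filter_ringOfSetsType _)) => x H.
    rewrite in_itv/= => /andP[x1 x2]; apply: H; rewrite in_itv/=.
    have := node_le ab N0 (leq0n j); have := node_le ab N0 jN.
    rewrite node0 nodeN// => bj ja.
    by rewrite (le_trans ja x1)/= (le_trans x2)// -nodeSE.
  have wq' x : node j < x < node j + h -> w x = q.[x].
    by move=> xc; apply: wq; rewrite /cell /= in_itv/= -/node nodeSE.
  have [|a1 [a2 [gm [gp H]]]] := cell_error_decomposition h0 M0 K1 HK cu wg gMj
    (du _) (du _) sq wq'.
    by move=> v sv; have := mom v sv; rewrite /cell -/node nodeSE.
  exists ((a1, a2), (gm, gp)) => _; move: H => [H1 H2 H3 H4]; split.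
  - by rewrite /trm -/node nodeSE.
  - exact: H2.
  - exact: H3.
  - by move=> x xc; apply: H4; move: xc; rewrite /cell /= in_itv/= -/node nodeSE.
have [d dP] := choice data.
pose a1 j := (d j).1.1; pose a2 j := (d j).1.2.
pose gm j := (d j).2.1; pose gp j := (d j).2.2.
have {}dP j : (j < N)%N -> [/\
    trm a b N w j = u (node j.+1) + (a1 j + a2 j) /\
    trm a b N (derive1 w) j = derive1 u (node j.+1) +
      ((k * (k - 1) * a1 j + k * (k + 1) * a2 j) / h + gm j),
    lim (w y @[y --> (node j)^'+]) = u (node j) + (gp j + sg * (a1 j - a2 j)) /\
    lim (derive1 w y @[y --> (node j)^'+]) = derive1 u (node j) +
      sg * (- (k * (k - 1)) * a1 j + k * (k + 1) * a2 j) / h,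
    `|gp j| <= E /\ h * `|gm j| <= E &
    forall x, cell a b N j x -> `|w x - u x| <= E + T + K * (`|a1 j| + `|a2 j|)].
  by move=> jN; have := dP j jN; rewrite /a1 /a2 /gm /gp; case: (d j) => [[? ?] [? ?]].
(* Periodicity acts only at the last interface, whose right trace is taken at node 0. *)
have wrap (f : R -> R) j : (forall x, f (x + (b - a)) = f x) -> (j < N)%N ->
    f (node (j.+1 %% N)%N) = f (node j.+1).
  move=> fper; rewrite leq_eqVlt => /predU1P[->|jN]; last by rewrite modn_small.
  rewrite modnn /node node0 nodeN// -(fper a); congr f; ring.
have sg2 : sg ^+ 2 = 1 by rewrite sqrr_sign.
(* As [k = n.+1], the sign [sg] is [(-1)^(k-1)], and the hypothesis on the parity of [k] becomes one
   identity. *)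
have sgG : - sg * G = L.
  rewrite Gk /sg -signr_odd /=; case: (odd n) => /=; rewrite ?expr0 ?expr1; ring.
have [B1 B2] : (forall j, (j < N)%N -> `|a1 j| <= N%:R / 2 * (W * E + N%:R / 2 * (nu * (W * E)))) /\
   (forall j, (j < N)%N -> `|a2 j| <= N%:R / 2 * (W * E + N%:R / 2 * (nu * (W * E)))).
  have H := @stability_bound R n a b alpha1 beta1 beta2 sg E N a1 a2 gm gp ab oN D0 sg2 sgG.
  suff H' : forall j, (j < N)%N ->
      `|a1 j| <= N%:R / 2 * (W * E + N%:R / 2 * (nu * (W * E))) /\
      `|a2 j| <= N%:R / 2 * (W * E + N%:R / 2 * (nu * (W * E))).
    by split=> j /H'[].
  apply: H => [j /dP[_ _ []]//|j /dP[_ _ []]//|j jN].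
  have [[m m'] _ _ _] := dP j jN.
  have [_ [t t'] _ _] := dP _ (ltn_pmod j.+1 N0).
  rewrite wrap// in t; rewrite (wrap (derive1 u))// in t'; last exact: derive1_periodic.
  have [_ ] := wP j jN; rewrite /avg /jump m m' /trp -/node t t' => E1 E2.
  rewrite -/h -/k; split.
    (* The weights of the two traces add up to one and the terms from [u] cancel in the jumps, so
       the data disappear. *)
    by apply: (addrI (u (node j.+1))); rewrite addr0 -[RHS]E1; field; rewrite hn0.
  by apply: (addrI (derive1 u (node j.+1))); rewrite addr0 -[RHS]E2; field; rewrite hn0.
pose A := N%:R / 2 * (W * E + N%:R / 2 * (nu * (W * E))).
have cellb j x : (j < N)%N -> cell a b N j x -> `|(w \- u) x| <= C0 * T * KK.
  move=> jN xc; have [_ _ _ /(_ x xc) H] := dP j jN.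
  apply: le_trans H _.
  apply: (@le_trans _ _ (E + T + K * (A + A))).
    by rewrite lerD2l ler_wpM2l// lerD ?B1 ?B2.
  have NE : N%:R = l * h^-1 :> R.
    by rewrite /h /mesh_size -/l invf_div mulrCA divff ?mulr1 ?gt_eqF.
  rewrite /A NE KKE /E /C0 -subr_ge0.
  move: (h^-1) hV0 => eta eta0.
  (* With [eta] for [h^-1], the gap between the two sides is a sum of products of nonnegative
     factors. *)
  have -> : (c + 1 + 2 * K * (l / 2) * (1 + l / 2) * c) * T * (1 + eta * (1 + eta * nu) * W) -
      (c * T + T + K * (l * eta / 2 * (W * (c * T) + l * eta / 2 * (nu * (W * (c * T)))) +
        l * eta / 2 * (W * (c * T) + l * eta / 2 * (nu * (W * (c * T)))))) =
      2 * K * (l / 2) * (1 + l / 2) * c * T + (c + 1) * (T * eta * W) +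
      K * (l * l / 2) * (eta * W * c * T) + (c + 1) * (T * (eta * eta) * nu * W) +
      K * l * (eta * eta * nu * W * c * T) by field.
  have l0' := ltW l0.
  by clearbody l W nu T c; rewrite !(addr_ge0, mulr_ge0, invr_ge0).
have B0 : 0 <= C0 * T * KK by apply: mulr_ge0; [apply: mulr_ge0 => //|]; exact: ltW.
have mwu : measurable_fun `[a, b] (w \- u).
  apply: (mesh_measurable ab N0) => j jN; have [q _ wq] := wV j jN.
  exists (fun x => q.[x] - u x).
    by move=> x; apply: continuousB; [exact: continuous_horner|exact: cu].
  by move=> x /wq; rewrite /= => ->.
have HLp := Lpnorm_le ab B0 mwu (mesh_ae N0 cellb) p2.
apply: (le_trans HLp).
rewrite SNE -!EFinM lee_fin -/l -/M.
have -> : C0 * T * KK * (1 + Num.sqrt l) = C0 * (1 + Num.sqrt l) * h ^+ n.+2 * M * KK.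
  by rewrite /T; ring.
exact: lexx.
Qed.
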